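(* For $X>0$ let $I(X)$ be the number of imaginary quadratic fields $K$ with $|\Delta_K| < X$ such that there exists an elliptic curve $E/K$ with everywhere good reduction over $K$ and rational $j$-invariant $j(E)\in\mathbb{Q}$. Then $$I(X) \gg \frac{X}{\sqrt{\log X}}.$$
   Context: $\Delta_K$ denotes the discriminant of $K$. An elliptic curve $E/K$ has everywhere good reduction if it has good reduction at every prime of $\mathcal{O}_K$. *)

(* Defs.v *)
From Stdlib Require Import ZArith QArith Qcanon Reals List.

Definition squarefree (d : Z) : Prop :=
  forall n : Z, Z.divide (n * n) d -> (n * n = 1)%Z.

Definition field_disc (d : Z) : Z :=
  if Z.eqb (Z.modulo d 4) 1 then d else (4 * d)%Z.

(** Elements a + b*sqrt d of K = Q(sqrt d). *)
Record K := mkK { re : Qc ; im : Qc }.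

Definition QcZ (z : Z) : Qc := Q2Qc (inject_Z z).
Definition Kof (q : Qc) : K := mkK q (Q2Qc 0).
Definition KZ (z : Z) : K := Kof (QcZ z).
Definition K0 : K := KZ 0.
Definition K1 : K := KZ 1.
Definition Kadd (x y : K) : K := mkK (Qcplus (re x) (re y)) (Qcplus (im x) (im y)).
Definition Kopp (x : K) : K := mkK (Qcopp (re x)) (Qcopp (im x)).
Definition Ksub (x y : K) : K := Kadd x (Kopp y).
Definition Kmul (d : Z) (x y : K) : K :=
  mkK (Qcplus (Qcmult (re x) (re y)) (Qcmult (QcZ d) (Qcmult (im x) (im y))))
      (Qcplus (Qcmult (re x) (im y)) (Qcmult (im x) (re y))).
Definition Kinv (d : Z) (x : K) : K :=
  let N := Qcminus (Qcmult (re x) (re x)) (Qcmult (QcZ d) (Qcmult (im x) (im x))) in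
  mkK (Qcmult (re x) (Qcinv N)) (Qcopp (Qcmult (im x) (Qcinv N))).
Fixpoint Kpow (d : Z) (x : K) (n : nat) : K :=
  match n with O => K1 | S n => Kmul d x (Kpow d x n) end.
Definition Kscal (d : Z) (z : Z) (x : K) : K := Kmul d (KZ z) x.

(** * Ring of integers O_K: elements that are roots of a monic integer polynomial.
    For cs = [c0; ...; c_{n-1}], the polynomial is X^n + c_{n-1} X^{n-1} + ... + c0. *)
Definition eval_monic (d : Z) (cs : list Z) (x : K) : K :=
  fold_right (fun c acc => Kadd (KZ c) (Kmul d x acc)) K1 cs.

Definition integral (d : Z) (x : K) : Prop :=
  exists cs : list Z, eval_monic d cs x = K0.

Definition prime_ideal (d : Z) (P : K -> Prop) : Prop :=
  (forall x, P x -> integral d x) /\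
  P K0 /\
  (forall x y, P x -> P y -> P (Kadd x y)) /\
  (forall r x, integral d r -> P x -> P (Kmul d r x)) /\
  ~ P K1 /\
  (forall a b, integral d a -> integral d b -> P (Kmul d a b) -> P a \/ P b) /\
  (exists x, P x /\ x <> K0).

Definition in_local (d : Z) (P : K -> Prop) (x : K) : Prop :=
  exists a b, integral d a /\ integral d b /\ ~ P b /\ Kmul d x b = a.

Definition local_unit (d : Z) (P : K -> Prop) (x : K) : Prop :=
  in_local d P x /\ exists y, in_local d P y /\ Kmul d x y = K1.

Record WE := mkWE { a1 : K ; a2 : K ; a3 : K ; a4 : K ; a6 : K }.

Section Invariants.
Variable d : Z.
Local Notation "x + y" := (Kadd x y).
Local Notation "x - y" := (Ksub x y).
Local Notation "x * y" := (Kmul d x y).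
Local Notation "n %* x" := (Kscal d n x) (at level 40).
Local Notation "x ^ n" := (Kpow d x n).

Definition b2 (E : WE) : K := a1 E ^ 2 + 4 %* a2 E.
Definition b4 (E : WE) : K := 2 %* a4 E + a1 E * a3 E.
Definition b6 (E : WE) : K := a3 E ^ 2 + 4 %* a6 E.
Definition b8 (E : WE) : K :=
  a1 E ^ 2 * a6 E + 4 %* (a2 E * a6 E) - a1 E * a3 E * a4 E
  + a2 E * a3 E ^ 2 - a4 E ^ 2.
Definition c4 (E : WE) : K := b2 E ^ 2 - 24 %* b4 E.
Definition disc_WE (E : WE) : K :=
  Kopp (b2 E ^ 2 * b8 E) - 8 %* (b4 E ^ 3) - 27 %* (b6 E ^ 2)
  + 9 %* (b2 E * b4 E * b6 E).
Definition jinv (E : WE) : K := c4 E ^ 3 * Kinv d (disc_WE E).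

(** E' is obtained from E by the change of variables
    x = u^2 x' + r, y = u^3 y' + s u^2 x' + t  (Silverman, Table 3.1). *)
Definition iso_model (E E' : WE) : Prop :=
  exists u r s t : K, u <> K0 /\
    u * a1 E' = a1 E + 2 %* s /\
    u ^ 2 * a2 E' = a2 E - s * a1 E + 3 %* r - s ^ 2 /\
    u ^ 3 * a3 E' = a3 E + r * a1 E + 2 %* t /\
    u ^ 4 * a4 E' = a4 E - s * a3 E + 2 %* (r * a2 E) - (t + r * s) * a1 E
                    + 3 %* (r ^ 2) - 2 %* (s * t) /\
    u ^ 6 * a6 E' = a6 E + r * a4 E + r ^ 2 * a2 E + r ^ 3 - t * a3 E
                    - t ^ 2 - r * t * a1 E.
End Invariants.

Definition elliptic (d : Z) (E : WE) : Prop := disc_WE d E <> K0.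

Definition good_reduction_at (d : Z) (P : K -> Prop) (E : WE) : Prop :=
  exists E', iso_model d E E' /\
    in_local d P (a1 E') /\ in_local d P (a2 E') /\ in_local d P (a3 E') /\
    in_local d P (a4 E') /\ in_local d P (a6 E') /\
    local_unit d P (disc_WE d E').

Definition everywhere_good (d : Z) (E : WE) : Prop :=
  forall P, prime_ideal d P -> good_reduction_at d P E.

Definition j_rational (d : Z) (E : WE) : Prop := im (jinv d E) = Q2Qc 0.

Definition good_field (d : Z) : Prop :=
  (d < 0)%Z /\ squarefree d /\
  exists E : WE, elliptic d E /\ j_rational d E /\ everywhere_good d E.

(* Main.v *)
(** Take j = 16^3, for which j - 1728 = 37 * 8^2. Over K = Q(sqrt d) with d = -37 n the
    curves with this invariant are the twists y^2 + y = x^3 + w x^2 + ... of discriminant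
    (w^2 / 37)^3. Such a twist has good reduction everywhere as soon as w = 1 mod 4 and
    (w^2 / 37) is the fourth power of an ideal, and w = 37 x + 2 y sqrt d does the job when
    4 n y^2 = z^2 - 37 x^2 with x, y, z odd, gcd (x, z) = 1, n = 3 mod 4 and n is squarefree
    and prime to 37: then w times its conjugate is 37 z^2.

    By descent every odd n dividing some a^2 - 37 satisfies such a norm equation, and norms
    multiply; by a Gauss sum in characteristic p, 37 is a square modulo p when the Legendre
    symbol chi(p) = (p/37) is 1. So it suffices to count squarefree products of primes with
    chi(p) = 1. Chebyshev's and Mertens' methods, together with L(1, chi) > 0, give
    sum_{p <= x, chi(p) = 1} log p / p = (log x) / 2 + O(1), and the same for chi(p) = -1.
    Sieving out the primes with chi(p) = -1 shows that sum_{m <= x} 1 / m over the good m is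
    >> sqrt (log x); multiplying good m <= Z by one prime p > Z with chi(p) = 1, where Z^2 is
    about x, gives the lower bound x / sqrt (log x). *)

Require Import Defs.
From Stdlib Require Import ZArith QArith Qcanon List Znumtheory Zwf Lia.
From Stdlib Require Classical_Prop.

(** * Arithmetic of [Q(sqrt d)] *)

Section QuadraticField.
Variable d : Z.
Hypothesis dneg : (d < 0)%Z.

Definition Kdiv (x y : K) : K := Kmul d x (Kinv d y).

Lemma K_ext x y : re x = re y -> im x = im y -> x = y.
Proof. destruct x, y; simpl; intros -> ->; reflexivity. Qed.

Lemma QcZ_add a b : QcZ (a + b) = (QcZ a + QcZ b)%Qc.
Proof.
apply Qc_is_canon; unfold QcZ, Qcplus, Q2Qc; cbn [this].
rewrite !Qred_correct, inject_Z_plus; reflexivity.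
Qed.

Lemma QcZ_mul a b : QcZ (a * b) = (QcZ a * QcZ b)%Qc.
Proof.
apply Qc_is_canon; unfold QcZ, Qcmult, Q2Qc; cbn [this].
rewrite !Qred_correct, inject_Z_mult; reflexivity.
Qed.

Lemma QcZ_opp a : QcZ (- a) = (- QcZ a)%Qc.
Proof.
apply Qc_is_canon; unfold QcZ, Qcopp, Q2Qc; cbn [this].
rewrite !Qred_correct, inject_Z_opp; reflexivity.
Qed.

Lemma QcZ_inj a b : QcZ a = QcZ b -> a = b.
Proof.
intros H; apply (f_equal this) in H; unfold QcZ, Q2Qc in H; cbn [this] in H.
assert (E : Qeq (inject_Z a) (inject_Z b)).
{ rewrite <- (Qred_correct (inject_Z a)), <- (Qred_correct (inject_Z b)), H; reflexivity. }
unfold Qeq in E; simpl in E; lia.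
Qed.

Lemma QcZ_lt a b : (a < b)%Z -> (QcZ a < QcZ b)%Qc.
Proof.
intros H; unfold Qclt, QcZ, Q2Qc; cbn [this]; rewrite !Qred_correct.
unfold Qlt; simpl; lia.
Qed.

Lemma Qc_sqr_nonneg (a : Qc) : (0 <= a * a)%Qc.
Proof.
unfold Qcle, Qcmult, Q2Qc; cbn [this]; rewrite !Qred_correct.
unfold Qle, Qmult; cbn [Qnum Qden]; nia.
Qed.

(** As [d < 0], a nonzero [b] would make [a * a = d * (b * b)] negative. This norm is the
    denominator in [Kinv], so [Kinv] inverts every nonzero element. *)
Lemma K_norm_eq0 (a b : Qc) : (a * a - QcZ d * (b * b) = 0 -> a = 0 /\ b = 0)%Qc.
Proof.
intros H.
assert (Hb : b = Q2Qc 0).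
{ destruct (Qc_eq_dec b (Q2Qc 0)) as [|nb]; [assumption|exfalso].
  assert (E : (a * a = QcZ d * (b * b))%Qc).
  { replace (a * a)%Qc with ((a * a - QcZ d * (b * b)) + QcZ d * (b * b))%Qc by ring.
    rewrite H; ring. }
  assert (B : (0 < b * b)%Qc).
  { destruct (Qcle_lt_or_eq _ _ (Qc_sqr_nonneg b)) as [|e]; [assumption|].
    symmetry in e; destruct (Qcmult_integral _ _ e); contradiction. }
  assert (A := Qc_sqr_nonneg a).
  assert (D : (QcZ d * (b * b) < 0 * (b * b))%Qc).
  { apply Qcmult_lt_compat_r; [assumption|]. apply (QcZ_lt d 0), dneg. }
  rewrite <- E in D. replace (0 * (b * b))%Qc with 0%Qc in D by ring.
  exact (Qclt_not_le _ _ D A). }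
subst b. split; [|reflexivity].
replace (a * a - QcZ d * (Q2Qc 0 * Q2Qc 0))%Qc with (a * a)%Qc in H by ring.
destruct (Qcmult_integral _ _ H); assumption.
Qed.

Lemma K_field_theory :
  field_theory K0 K1 Kadd (Kmul d) Ksub Kopp Kdiv (Kinv d) eq.
Proof.
constructor.
- constructor; intros; apply K_ext; simpl; try reflexivity;
    change (QcZ 0) with (Q2Qc 0); change (QcZ 1) with (Q2Qc 1); ring.
- intros H; apply (f_equal re) in H; simpl in H.
  apply QcZ_inj in H; lia.
- reflexivity.
- intros p Hp.
  assert (N : (re p * re p - QcZ d * (im p * im p) <> 0)%Qc).
  { intros N; apply K_norm_eq0 in N; destruct N as [A B]; apply Hp.
    apply K_ext; [rewrite A|rewrite B]; reflexivity. }
  apply K_ext; simpl; change (QcZ 1) with (Q2Qc 1); change (Q2Qc 1) with 1%Qc;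
    change (Q2Qc 0) with 0%Qc; field; exact N.
Qed.

(** Lets [ring] and [field] compute with the integer constants [KZ z]. *)
Lemma KZ_morph :
  ring_morph K0 K1 Kadd (Kmul d) Ksub Kopp eq 0%Z 1%Z Z.add Z.mul Z.sub Z.opp Z.eqb KZ.
Proof.
constructor; try reflexivity; intros; apply K_ext; simpl.
- apply QcZ_add.
- reflexivity.
- unfold Z.sub; rewrite QcZ_add, QcZ_opp; reflexivity.
- reflexivity.
- rewrite QcZ_mul; ring.
- ring.
- apply QcZ_opp.
- reflexivity.
- apply Z.eqb_eq in H; rewrite H; reflexivity.
- reflexivity.
Qed.

Lemma KZ_inj a b : KZ a = KZ b -> a = b.
Proof. intros H; apply (f_equal re) in H; exact (QcZ_inj _ _ H). Qed.

Ltac Kcst t := match t with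
  | KZ ?z => match isZcst z with true => z | _ => constr:(InitialRing.NotConstant) end
  | K0 => constr:(0%Z) | K1 => constr:(1%Z)
  | _ => constr:(InitialRing.NotConstant) end.

Add Field Kfield : K_field_theory (morphism KZ_morph, constants [Kcst]).

Local Notation "x +' y" := (Kadd x y) (at level 50, left associativity).
Local Notation "x -' y" := (Ksub x y) (at level 50, left associativity).
Local Notation "x *' y" := (Kmul d x y) (at level 40, left associativity).
Local Notation "x /' y" := (Kdiv x y) (at level 40, left associativity).

Lemma KZ_add a b : KZ (a + b) = KZ a +' KZ b.
Proof. exact (morph_add KZ_morph a b). Qed.
Lemma KZ_mul a b : KZ (a * b) = KZ a *' KZ b.
Proof. exact (morph_mul KZ_morph a b). Qed.
Lemma KZ_sub a b : KZ (a - b) = KZ a -' KZ b.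
Proof. exact (morph_sub KZ_morph a b). Qed.
Lemma KZ_opp a : KZ (- a) = Kopp (KZ a).
Proof. exact (morph_opp KZ_morph a). Qed.

Lemma KZ_neq0 z : z <> 0%Z -> KZ z <> K0.
Proof. intros nz H; apply nz, KZ_inj, H. Qed.

Lemma K_integral x y : x *' y = K0 -> x = K0 \/ y = K0.
Proof.
intros H.
assert (Dx : x = K0 \/ x <> K0).
{ destruct (Qc_eq_dec (re x) 0%Qc) as [e1|n1], (Qc_eq_dec (im x) 0%Qc) as [e2|n2];
  [left; apply K_ext; assumption|right|right|right]; intros E; subst x; auto. }
destruct Dx as [|nx]; [left; assumption|right].
replace y with ((x *' y) /' x) by (field; assumption).
rewrite H; field; assumption.
Qed.

Lemma K_mul_neq0 x y : x <> K0 -> y <> K0 -> x *' y <> K0.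
Proof. intros nx ny H; destruct (K_integral _ _ H); contradiction. Qed.

(** * The order [Z[theta]] for [d = 1] mod [4] *)

Variable e : Z.
Hypothesis d_mod4 : d = (4 * e + 1)%Z.

Definition sqd : K := mkK (Q2Qc 0) (Q2Qc 1).
Definition theta : K := (K1 +' sqd) /' KZ 2.

Lemma sqd_sqr : sqd *' sqd = KZ d.
Proof. apply K_ext; simpl; ring. Qed.

Lemma theta_sqr : theta *' theta = theta +' KZ e.
Proof.
transitivity ((K1 +' KZ 2 *' sqd +' sqd *' sqd) /' KZ 4).
- unfold theta; field; split; apply KZ_neq0; discriminate.
- rewrite sqd_sqr.
  replace (KZ d) with (KZ 4 *' KZ e +' K1)
    by (rewrite d_mod4 at 2; rewrite KZ_add, KZ_mul; reflexivity).
  unfold theta; field.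
  split; apply KZ_neq0; discriminate.
Qed.

Lemma sqd_theta : sqd = KZ 2 *' theta -' K1.
Proof. unfold theta; field; apply KZ_neq0; discriminate. Qed.

(** The ring [Z[theta]] in coordinates; for squarefree [d] it is the whole ring of integers. *)
Definition inO (x : K) : Prop := exists a b, x = KZ a +' KZ b *' theta.

Lemma inO_integral x : inO x -> integral d x.
Proof.
intros (a & b & ->).
(* The characteristic polynomial of [a + b theta]: trace [2 a + b], norm [a^2 + a b - e b^2]. *)
exists ((a * a + a * b - e * (b * b)) :: (- (2 * a + b)) :: nil)%Z; cbn [eval_monic fold_right].
transitivity (KZ b *' KZ b *' (theta *' theta -' theta -' KZ e)).
- rewrite !KZ_opp, !KZ_sub, !KZ_add, !KZ_mul; ring.
- rewrite theta_sqr; ring.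
Qed.

Lemma inO_KZ z : inO (KZ z).
Proof. exists z, 0%Z; ring. Qed.

Lemma inO_sqd : inO sqd.
Proof. exists (-1)%Z, 2%Z; rewrite sqd_theta; ring. Qed.

Lemma inO_theta : inO theta.
Proof. exists 0%Z, 1%Z; ring. Qed.

Lemma inO_add x y : inO x -> inO y -> inO (x +' y).
Proof.
intros (a & b & ->) (a' & b' & ->); exists (a + a')%Z, (b + b')%Z.
rewrite !KZ_add; ring.
Qed.

Lemma inO_mul x y : inO x -> inO y -> inO (x *' y).
Proof.
intros (a & b & ->) (a' & b' & ->).
exists (a * a' + e * (b * b'))%Z, (a * b' + a' * b + b * b')%Z.
transitivity (KZ a *' KZ a' +' (KZ a *' KZ b' +' KZ a' *' KZ b) *' theta
  +' KZ b *' KZ b' *' (theta *' theta)); [ring|].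
rewrite theta_sqr, !KZ_add, !KZ_mul; ring.
Qed.

Lemma inO_opp x : inO x -> inO (Kopp x).
Proof.
intros Hx; replace (Kopp x) with (KZ (-1) *' x) by ring.
apply inO_mul; [apply inO_KZ|assumption].
Qed.

Lemma inO_sub x y : inO x -> inO y -> inO (x -' y).
Proof.
intros Hx Hy; replace (x -' y) with (x +' Kopp y) by ring.
apply inO_add, inO_opp; assumption.
Qed.

(** * Prime ideals and local units *)

Section AtPrime.
Variable P : K -> Prop.
Hypothesis Pprime : prime_ideal d P.

Lemma P_add x y : P x -> P y -> P (x +' y).
Proof. apply Pprime. Qed.
Lemma P_mull r x : inO r -> P x -> P (r *' x).
Proof. intros Hr; apply Pprime, inO_integral, Hr. Qed.
Lemma P_mulr r x : inO r -> P x -> P (x *' r).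
Proof. intros Hr Px; replace (x *' r) with (r *' x) by ring; apply P_mull; assumption. Qed.
Lemma P_sub x y : P x -> P y -> P (x -' y).
Proof.
intros Px Py; replace (x -' y) with (x +' KZ (-1) *' y) by ring.
apply P_add, P_mull; [assumption|apply inO_KZ|assumption].
Qed.
Lemma P_not1 : ~ P K1.
Proof. apply Pprime. Qed.
Lemma P_prime x y : inO x -> inO y -> P (x *' y) -> P x \/ P y.
Proof. intros Hx Hy; apply Pprime; apply inO_integral; assumption. Qed.
Lemma notP_mul x y : inO x -> inO y -> ~ P x -> ~ P y -> ~ P (x *' y).
Proof. intros Hx Hy nx ny H; destruct (P_prime _ _ Hx Hy H); contradiction. Qed.
Lemma P_coprime a b : Z.gcd a b = 1%Z -> P (KZ a) -> ~ P (KZ b).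
Proof.
intros G Pa Pb; apply P_not1.
destruct (Z.gcd_bezout a b 1 G) as (u & v & E).
replace K1 with (KZ u *' KZ a +' KZ v *' KZ b).
- apply P_add; apply P_mull; auto using inO_KZ.
- rewrite <- !KZ_mul, <- KZ_add, E; reflexivity.
Qed.

Lemma P_neq0 x : ~ P x -> x <> K0.
Proof. intros nx ->; apply nx, Pprime. Qed.

Lemma in_local_div a b : inO a -> inO b -> ~ P b -> in_local d P (a /' b).
Proof.
intros Ha Hb nb; exists a, b; repeat split; auto using inO_integral.
field; apply P_neq0, nb.
Qed.

Lemma in_local_O a : inO a -> in_local d P a.
Proof.
intros Ha; replace a with (a /' K1) by (field; apply (KZ_neq0 1); discriminate).
apply in_local_div; [assumption|apply (inO_KZ 1)|apply P_not1].
Qed.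

Lemma local_unit_div a b :
  inO a -> inO b -> ~ P a -> ~ P b -> local_unit d P (a /' b).
Proof.
intros Ha Hb na nb; split; [apply in_local_div; assumption|].
exists (b /' a); split; [apply in_local_div; assumption|].
field; split; apply P_neq0; assumption.
Qed.

End AtPrime.

(** The model [y^2 + y = x^3 + w x^2 + (12 w^2 / 37) x + (5 w^3 / 37 - 1) / 4]
    has [c4 = 16 w^2 / 37] and [c6 = 8 w^3 / 37] up to sign: it is the curve
    with j-invariant [16^3] twisted by [w]. *)
Definition twist (w : K) : WE :=
  mkWE K0 w K1 ((KZ 12 *' (w *' w)) /' KZ 37)
    ((KZ 5 *' (w *' (w *' w)) -' KZ 37) /' KZ 148).

Ltac Kunf := unfold disc_WE, jinv, c4, b2, b4, b6, b8, twist, Kscal; cbn [a1 a2 a3 a4 a6 Kpow].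
Ltac Kside := repeat split; try (apply KZ_neq0; discriminate).

Lemma twist_disc w : disc_WE d (twist w) =
  (w *' w /' KZ 37) *' (w *' w /' KZ 37) *' (w *' w /' KZ 37).
Proof. Kunf. field. Kside. Qed.

Lemma twist_jinv w : w <> K0 -> jinv d (twist w) = KZ 4096.
Proof.
intros nw; unfold jinv; rewrite twist_disc.
change (Kmul d ?x (Kinv d ?y)) with (Kdiv x y).
Kunf. field. Kside; assumption.
Qed.

(** Twisting depends on [w] only up to squares; [t = (u^3 - 1) / 2] restores [a3 = 1] after scaling
    by [u]. *)
Lemma twist_scale u w : u <> K0 -> iso_model d (twist (u *' u *' w)) (twist w).
Proof.
intros nu; exists u, K0, K0, ((u *' u *' u -' K1) /' KZ 2).
split; [assumption|]; Kunf.
repeat split; field; Kside.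
Qed.

(** Good reduction at [P] may be tested on a representative [w0] of the square class of [w] that
    varies with [P]. *)
Lemma twist_good_at P u w w0 : u <> K0 -> w = u *' u *' w0 ->
  prime_ideal d P ->
  in_local d P w0 -> in_local d P ((KZ 12 *' (w0 *' w0)) /' KZ 37) ->
  in_local d P ((KZ 5 *' (w0 *' (w0 *' w0)) -' KZ 37) /' KZ 148) ->
  local_unit d P ((w0 *' w0 /' KZ 37) *' (w0 *' w0 /' KZ 37) *' (w0 *' w0 /' KZ 37)) ->
  good_reduction_at d P (twist w).
Proof.
intros nu -> HP H2 H4 H6 HD; exists (twist w0); split; [apply twist_scale, nu|].
rewrite twist_disc; cbn [twist a1 a2 a3 a4 a6].
repeat split; auto; try apply HD; apply in_local_O; auto;
  [apply (inO_KZ 0)|apply (inO_KZ 1)].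
Qed.

(** * Good reduction from the norm equation *)

Variables n x y z : Z.
Hypothesis d_n : d = (- 37 * n)%Z.
Hypothesis norm_eq : (4 * n * y * y = z * z - 37 * x * x)%Z.
Hypothesis y_odd : Z.Odd y.
Hypothesis x_mod4 : (x mod 4 = 3)%Z.
Hypothesis gcd_xz : Z.gcd x z = 1%Z.
Hypothesis n_37 : ~ (37 | n)%Z.

Let w : K := KZ (37 * x) +' KZ (2 * y) *' sqd.
Let wbar : K := KZ (37 * x) -' KZ (2 * y) *' sqd.
(** This is [w^2 / 37], so that [twist w] has discriminant [v^3]. *)
Let v : K := KZ (37 * x * x - 4 * n * y * y) +' KZ (4 * x * y) *' sqd.

Lemma prime_37 : prime 37.
Proof.
apply prime_intro; [lia|]; intros [|m|m] Hm; try lia; apply Zgcd_1_rel_prime.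
do 6 (destruct m as [m|m|]; try lia; try reflexivity).
Qed.

(** If [37 | y], the norm equation gives [37 | z] and then [37 | x], against [gcd_xz]. *)
Lemma y_37 : ~ (37 | y)%Z.
Proof.
intros (k & ->).
assert (Z37 : (37 | z)%Z).
{ destruct (prime_mult 37 prime_37 z z); auto.
  exists (4 * n * k * k * 37 + x * x)%Z; lia. }
destruct Z37 as (l & El).
assert (X37 : (37 | x)%Z).
{ destruct (prime_mult 37 prime_37 x x); auto.
  exists (l * l - 4 * n * k * k)%Z; nia. }
assert (D : (37 | Z.gcd x z)%Z) by (apply Z.gcd_greatest; [assumption|exists l; assumption]).
rewrite gcd_xz in D; destruct D as (t & Et); lia.
Qed.

Lemma w_wbar : w *' wbar = KZ 37 *' (KZ z *' KZ z).
Proof.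
unfold w, wbar.
transitivity (KZ (37 * x) *' KZ (37 * x) -' KZ (2 * y) *' KZ (2 * y) *' (sqd *' sqd)); [ring|].
rewrite sqd_sqr, <- !KZ_mul, <- KZ_sub; f_equal; rewrite d_n; nia.
Qed.

Lemma w_sqr : w *' w = KZ 37 *' v.
Proof.
unfold w, v.
transitivity (KZ (37 * x) *' KZ (37 * x) +' KZ (2 * y) *' KZ (2 * y) *' (sqd *' sqd)
  +' (KZ 2 *' KZ (37 * x) *' KZ (2 * y)) *' sqd); [ring|].
rewrite sqd_sqr, <- !KZ_mul, <- KZ_add.
transitivity (KZ (37 * (37 * x * x - 4 * n * y * y)) +' KZ (37 * (4 * x * y)) *' sqd).
- f_equal; [|f_equal]; f_equal; [rewrite d_n|]; lia.
- rewrite !(KZ_mul 37); ring.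
Qed.

Lemma inO_w : inO w.
Proof. apply inO_add, inO_mul; auto using inO_KZ, inO_sqd. Qed.
Lemma inO_wbar : inO wbar.
Proof. apply inO_sub, inO_mul; auto using inO_KZ, inO_sqd. Qed.
Lemma inO_v : inO v.
Proof. apply inO_add, inO_mul; auto using inO_KZ, inO_sqd. Qed.

(** Here [w = (37 x - 2 y) + 4 y theta], and [37 x - 2 y] is [1] mod [4] because [x = 3] mod [4] and
    [y] is odd. This makes the coefficient [a6] of [twist w] integral above [2]. *)
Lemma w_mod4 : exists k, inO k /\ w = K1 +' KZ 4 *' k.
Proof.
assert (A : exists a, (37 * x - 2 * y = 1 + 4 * a)%Z).
{ destruct y_odd as (b & ->); exists ((37 * x - 2 * (2 * b + 1) - 1) / 4)%Z.
  assert (E := Z.div_mod x 4); assert (F := Z.div_mod (37 * x - 2 * (2 * b + 1) - 1) 4).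
  rewrite x_mod4 in E.
  assert ((37 * x - 2 * (2 * b + 1) - 1) mod 4 = 0)%Z; [|lia].
  replace (37 * x - 2 * (2 * b + 1) - 1)%Z with ((37 * (x / 4) - b + 27) * 4)%Z by lia.
  apply Z.mod_mul; lia. }
destruct A as (a & Ea).
exists (KZ a +' KZ y *' theta); split.
- apply inO_add, inO_mul; auto using inO_KZ, inO_theta.
- unfold w; rewrite sqd_theta.
  transitivity (KZ (37 * x - 2 * y) +' KZ 4 *' KZ y *' theta).
  + rewrite KZ_sub, (KZ_mul 2 y); ring.
  + rewrite Ea, KZ_add, KZ_mul; change (KZ 1) with K1; ring.
Qed.

Lemma z_neq0 : z <> 0%Z.
Proof.
assert (N : (0 < n)%Z) by lia.
assert (Y : y <> 0%Z) by (destruct y_odd; lia).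
nia.
Qed.

Lemma w_neq0 : w <> K0.
Proof.
intros E; assert (W := w_wbar); rewrite E in W.
apply (K_mul_neq0 (KZ 37) (KZ z *' KZ z));
  [apply KZ_neq0; lia|apply K_mul_neq0; apply KZ_neq0, z_neq0|].
rewrite <- W; ring.
Qed.

(** If [w] is outside [P], the model [twist w] is already good. Otherwise [2] is outside [P], and so
    is [wbar]: with [w] it would put the coprime integers [x] and [z] into [P]. Then [w] is [z^2]
    times the local unit [37 / wbar]. *)
Lemma w_good_away_37 P : prime_ideal d P -> ~ P (KZ 37) -> good_reduction_at d P (twist w).
Proof.
intros HP n37.
assert (Ow := inO_w); assert (Ob := inO_wbar).
destruct w_mod4 as (k & Ok & Ek).
assert (D : P w \/ ~ P w) by apply Classical_Prop.classic.
destruct D as [Pw|nPw].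
- assert (n2 : ~ P (KZ 2)).
  { intros P2; apply (P_not1 P HP).
    replace K1 with (w -' KZ 2 *' (KZ 2 *' k)) by (rewrite Ek; ring).
    apply P_sub; auto; apply P_mulr; auto; apply inO_mul; auto using inO_KZ. }
  assert (nb : ~ P wbar).
  { intros Pb.
    assert (Px : P (KZ x)).
    { assert (H : P (KZ 2 *' (KZ 37 *' KZ x))).
      { replace (KZ 2 *' (KZ 37 *' KZ x)) with (w +' wbar).
        - apply P_add; auto.
        - unfold w, wbar; rewrite (KZ_mul 37); ring. }
      destruct (P_prime P HP _ _ (inO_KZ 2) (inO_mul _ _ (inO_KZ 37) (inO_KZ x)) H) as [|H'];
        [contradiction|].
      destruct (P_prime P HP _ _ (inO_KZ 37) (inO_KZ x) H'); [contradiction|assumption]. }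
    assert (Pz : P (KZ z)).
    { assert (H : P (KZ 37 *' (KZ z *' KZ z))).
      { rewrite <- w_wbar; apply P_mulr; auto. }
      destruct (P_prime P HP _ _ (inO_KZ 37) (inO_mul _ _ (inO_KZ z) (inO_KZ z)) H) as [|H'];
        [contradiction|].
      destruct (P_prime P HP _ _ (inO_KZ z) (inO_KZ z) H'); assumption. }
    exact (P_coprime P HP x z gcd_xz Px Pz). }
  assert (b0 := P_neq0 P HP _ nb).
  apply (twist_good_at P (KZ z) w (KZ 37 /' wbar)); auto.
  + apply KZ_neq0, z_neq0.
  + transitivity ((w *' wbar) /' wbar); [field; assumption|].
    rewrite w_wbar; field; assumption.
  + apply in_local_div; auto using inO_KZ.
  + replace (KZ 12 *' (KZ 37 /' wbar *' (KZ 37 /' wbar)) /' KZ 37)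
      with (KZ 12 *' KZ 37 /' (wbar *' wbar)) by (field; Kside; assumption).
    apply in_local_div; auto using inO_KZ, inO_mul, notP_mul.
  + replace ((KZ 5 *' (KZ 37 /' wbar *' (KZ 37 /' wbar *' (KZ 37 /' wbar))) -' KZ 37) /' KZ 148)
      with ((KZ 5 *' (KZ 37 *' KZ 37) -' wbar *' (wbar *' wbar))
            /' (KZ 2 *' (KZ 2 *' (wbar *' (wbar *' wbar))))) by (field; Kside; assumption).
    apply in_local_div; auto.
    * apply inO_sub; auto 6 using inO_KZ, inO_mul.
    * auto 7 using inO_KZ, inO_mul.
    * apply notP_mul; auto 7 using inO_KZ, inO_mul.
      apply notP_mul; auto 7 using inO_KZ, inO_mul, notP_mul.
  + match goal with |- local_unit _ _ ?a =>
      replace a with (KZ 37 *' (KZ 37 *' KZ 37)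
        /' ((wbar *' wbar) *' ((wbar *' wbar) *' (wbar *' wbar)))) by (field; Kside; assumption) end.
    apply local_unit_div; auto 7 using inO_KZ, inO_mul, notP_mul.
- apply (twist_good_at P K1 w w); auto.
  + apply (KZ_neq0 1); lia.
  + ring.
  + apply in_local_O; auto.
  + apply in_local_div; auto using inO_KZ, inO_mul.
  (* With [w = 1 + 4 k] every coefficient of [5 w^3 - 37] is divisible by [4], so only [37] stays in
     the denominator. *)
  + replace ((KZ 5 *' (w *' (w *' w)) -' KZ 37) /' KZ 148)
      with ((KZ (-8) +' k *' (KZ 15 +' k *' (KZ 60 +' KZ 80 *' k))) /' KZ 37)
      by (rewrite Ek; field; Kside).
    apply in_local_div; auto 10 using inO_KZ, inO_mul, inO_add.
  + match goal with |- local_unit _ _ ?a =>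
      replace a with ((w *' w) *' ((w *' w) *' (w *' w))
        /' (KZ 37 *' (KZ 37 *' KZ 37))) by (field; Kside) end.
    apply local_unit_div; auto 7 using inO_KZ, inO_mul, notP_mul.
Qed.

(** [P] contains [sqd], whose square is [-37 n]. If it also contained [v], it would contain
    [4 n y^2], which is prime to [37]. So [v] is a local unit, and [w^2 = 37 v] cancels the
    denominators [37]. *)
Lemma w_good_at_37 P : prime_ideal d P -> P (KZ 37) -> good_reduction_at d P (twist w).
Proof.
intros HP P37.
assert (Ow := inO_w); assert (Ov := inO_v).
assert (nv : ~ P v).
{ intros Pv.
  assert (Ps : P sqd).
  { assert (H : P (sqd *' sqd)).
    { rewrite sqd_sqr, d_n, KZ_mul; apply P_mulr; auto using inO_KZ.
      change (KZ (-37)) with (KZ (-1 * 37)); rewrite KZ_mul; apply P_mull; auto using inO_KZ. }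
    destruct (P_prime P HP _ _ inO_sqd inO_sqd H); assumption. }
  assert (H : P (KZ (4 * n * y * y))).
  { replace (KZ (4 * n * y * y))
      with (KZ 37 *' KZ (x * x) +' KZ (4 * x * y) *' sqd -' v).
    - apply P_sub; auto; apply P_add; auto; [apply P_mulr|apply P_mull]; auto using inO_KZ.
    - unfold v; rewrite <- KZ_mul, KZ_sub, Z.mul_assoc; ring. }
  apply (P_coprime P HP 37 (4 * n * y * y)); auto.
  apply Zgcd_1_rel_prime, prime_rel_prime; [apply prime_37|]; intros D.
  apply prime_mult in D; [|apply prime_37]; destruct D as [D|D]; [|exact (y_37 D)].
  apply prime_mult in D; [|apply prime_37]; destruct D as [D|D]; [|exact (y_37 D)].
  apply prime_mult in D; [|apply prime_37]; destruct D as [D|D]; [|exact (n_37 D)].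
  destruct D; lia. }
assert (n2 : ~ P (KZ 4)) by (apply (P_coprime P HP 37); auto).
assert (E : w *' w = KZ 37 *' v) by apply w_sqr.
apply (twist_good_at P K1 w w); auto.
- apply (KZ_neq0 1); lia.
- ring.
- apply in_local_O; auto.
- rewrite E; replace (KZ 12 *' (KZ 37 *' v) /' KZ 37) with (KZ 12 *' v) by (field; Kside).
  apply in_local_O; auto using inO_mul, inO_KZ.
- rewrite E.
  replace ((KZ 5 *' (w *' (KZ 37 *' v)) -' KZ 37) /' KZ 148)
    with ((KZ 5 *' (w *' v) -' K1) /' KZ 4) by (field; Kside).
  apply in_local_div; auto using inO_mul, inO_KZ.
  apply inO_sub; [auto using inO_mul, inO_KZ|apply (inO_KZ 1)].
- rewrite E; match goal with |- local_unit _ _ ?a =>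
    replace a with (v *' (v *' v) /' K1) by (field; split; [Kside|apply (KZ_neq0 1); lia]) end.
  apply local_unit_div; auto 7 using inO_mul, notP_mul, P_not1; apply (inO_KZ 1).
Qed.

Lemma twist_w_elliptic : elliptic d (twist w).
Proof.
unfold elliptic; rewrite twist_disc.
assert (W := w_neq0).
assert (H : w *' w /' KZ 37 <> K0).
{ intros H; apply (K_mul_neq0 w w W W).
  transitivity (KZ 37 *' (w *' w /' KZ 37)); [field; Kside|rewrite H; ring]. }
apply K_mul_neq0; [apply K_mul_neq0|]; assumption.
Qed.

Lemma twist_w_everywhere_good :
  exists E : WE, elliptic d E /\ j_rational d E /\ everywhere_good d E.
Proof.
exists (twist w); split; [apply twist_w_elliptic|split].
- unfold j_rational; rewrite twist_jinv by apply w_neq0; reflexivity.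
- intros P HP.
  destruct (Classical_Prop.classic (P (KZ 37)));
    [apply w_good_at_37|apply w_good_away_37]; assumption.
Qed.

End QuadraticField.

(** * The norm form of [Q(sqrt 37)] *)

Section NormForm.
Local Open Scope Z_scope.

Definition norm37 (n : Z) : Prop :=
  exists x y z, 4 * n * y * y = z * z - 37 * x * x /\ Z.Odd y.

Lemma norm_parity m x z : 4 * m = z * z - 37 * x * x -> exists k, z = x + 2 * k.
Proof.
intros H; destruct (Z.Even_or_Odd (z - x)) as [[k E]|[k E]]; [exists k; lia|exfalso].
replace z with (x + (2 * k + 1)) in H by lia.
assert (4 * m = 2 * (2 * (k * k) + 2 * k - 18 * (x * x) + 2 * x * k + x) + 1) by (rewrite H; ring).
lia.
Qed.

(* Composition of [(z1 + x1 sqrt 37) / 2] and [(z2 + x2 sqrt 37) / 2]. *)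
Lemma norm_mul m1 x1 z1 m2 x2 z2 :
  4 * m1 = z1 * z1 - 37 * x1 * x1 -> 4 * m2 = z2 * z2 - 37 * x2 * x2 ->
  exists x z, 4 * (m1 * m2) = z * z - 37 * x * x /\
    2 * x = z1 * x2 + x1 * z2 /\ 2 * z = z1 * z2 + 37 * x1 * x2.
Proof.
intros E1 E2.
destruct (norm_parity _ _ _ E1) as (k1 & F1), (norm_parity _ _ _ E2) as (k2 & F2).
exists (x1 * x2 + k1 * x2 + k2 * x1), (19 * x1 * x2 + k1 * x2 + k2 * x1 + 2 * k1 * k2).
split; [|split; subst; ring].
apply (Z.mul_reg_l _ _ 4); [lia|].
transitivity ((4 * m1) * (4 * m2)); [ring|].
rewrite E1, E2; subst; ring.
Qed.

Lemma norm37_mul n1 n2 : norm37 n1 -> norm37 n2 -> norm37 (n1 * n2).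
Proof.
intros (x1 & y1 & z1 & E1 & O1) (x2 & y2 & z2 & E2 & O2).
destruct (norm_mul (n1 * y1 * y1) x1 z1 (n2 * y2 * y2) x2 z2) as (x & z & E & _); try lia.
exists x, (y1 * y2), z; split; [lia|].
apply Z.odd_spec; rewrite Z.odd_mul; apply Z.odd_spec in O1, O2; rewrite O1, O2; reflexivity.
Qed.

Lemma norm37_1 : norm37 1.
Proof. exists 0, 1, 2; split; [reflexivity|exists 0; reflexivity]. Qed.

Lemma norm37_opp n : norm37 n -> norm37 (- n).
Proof.
intros H; replace (- n) with (-1 * n) by ring; apply norm37_mul; [|exact H].
(* [6 + sqrt 37] has norm [-1]. *)
exists 2, 1, 12; split; [reflexivity|exists 0; reflexivity].
Qed.

Lemma norm37_3 : norm37 3.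
Proof. exists 1, 1, 7; split; [reflexivity|exists 0; reflexivity]. Qed.

(** In [(p m) m = p m^2] the odd factor [m] is absorbed into [y]. *)
Lemma norm37_div p m : Z.Odd m -> norm37 m -> norm37 (p * m) -> norm37 p.
Proof.
intros Om Rm Rpm; destruct (norm37_mul _ _ Rpm Rm) as (x & y & z & E & Oy).
exists x, (m * y), z; split; [lia|].
apply Z.odd_spec; rewrite Z.odd_mul; apply Z.odd_spec in Om, Oy; rewrite Om, Oy; reflexivity.
Qed.

(* The cofactor in [a^2 - 37 = n m], with [a] even and [|a| < n], is odd and
   smaller than [n]: descent. *)
Lemma norm37_of_sqr_mod n a : 0 < n -> Z.Odd n -> (n | a * a - 37) -> norm37 n.
Proof.
intros n0; revert n0 a; pattern n; apply (well_founded_induction (Zwf_well_founded 0)).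
clear n; intros n IH n0 a [k On] D.
destruct (Z.eq_dec n 1) as [->|n1]; [apply norm37_1|].
destruct (Z.eq_dec n 3) as [->|n3]; [apply norm37_3|].
(* As [n] is odd, either the remainder of [a] or that remainder minus [n] is even; evenness makes
   the cofactor [m] odd. *)
assert (B : exists b, - n < 2 * b < n /\ (n | (2 * b) * (2 * b) - 37)).
{ assert (M := Z.mod_pos_bound a n n0); assert (E := Z.div_mod a n).
  destruct D as (q & Eq).
  destruct (Z.Even_or_Odd (a mod n)) as [[b Eb]|[b Eb]].
  - exists b; split; [lia|].
    exists (q - 2 * a * (a / n) + n * (a / n) * (a / n)).
    rewrite <- Eb; replace (a mod n) with (a - n * (a / n)) by lia.
    replace ((a - n * (a / n)) * (a - n * (a / n)) - 37) with
      ((a * a - 37) - n * (2 * a * (a / n)) + n * n * (a / n) * (a / n)) by ring.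
    rewrite Eq; ring.
  - exists (b - k); split; [lia|].
    exists (q - 2 * a * (a / n + 1) + n * (a / n + 1) * (a / n + 1)).
    replace (2 * (b - k)) with (a - n * (a / n + 1)) by lia.
    replace ((a - n * (a / n + 1)) * (a - n * (a / n + 1)) - 37) with
      ((a * a - 37) - n * (2 * a * (a / n + 1)) + n * n * (a / n + 1) * (a / n + 1)) by ring.
    rewrite Eq; ring. }
destruct B as (b & Bb & (m & Em)).
assert (Om : Z.Odd m).
{ destruct (Z.Even_or_Odd m) as [[j Ej]|]; [exfalso|assumption]; rewrite Ej in Em; lia. }
(* [37] is not a square modulo [5]. With [1] and [3] settled this leaves [n >= 7], where [37 < n^2]
   gives [|m| < n]. *)
assert (n5 : n <> 5).
{ intros ->.
  assert (C : b = -2 \/ b = -1 \/ b = 0 \/ b = 1 \/ b = 2) by lia.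
  destruct C as [->|[->|[->|[->| ->]]]]; lia. }
assert (m0 : 0 < Z.abs m) by (destruct Om; lia).
assert (mn : Z.abs m < n).
{ assert (n >= 7) by lia. apply Z.abs_lt. split; nia. }
assert (Rm : norm37 (Z.abs m)).
{ apply (IH (Z.abs m)) with (a := 2 * b); auto.
  - unfold Zwf; lia.
  - destruct (Z.abs_eq_or_opp m) as [->| ->]; auto.
    destruct Om as [j ->]; exists (- j - 1); lia.
  - apply Z.divide_abs_l; exists n; lia. }
apply (norm37_div n m Om).
- destruct (Z.abs_eq_or_opp m) as [E|E]; rewrite E in Rm; auto.
  apply norm37_opp in Rm; rewrite Z.opp_involutive in Rm; exact Rm.
- exists 2, 1, (2 * (2 * b)); split; [lia|exists 0; reflexivity].
Qed.

(* [(43 + 7 sqrt 37) / 2] has norm [9] and is not in [Z[sqrt 37]]. *)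
Lemma norm37_odd n : Z.Odd n -> norm37 n ->
  exists x y z, 4 * n * y * y = z * z - 37 * x * x /\ Z.Odd y /\ Z.Odd x.
Proof.
intros On (x & y & z & E & Oy).
destruct (Z.Even_or_Odd x) as [[x' Ex]|Ox]; [|exists x, y, z; auto].
destruct (norm_mul (n * y * y) x z 9 7 43) as (X & Z & EE & EX & _); try lia.
destruct (norm_parity (n * y * y) x z) as (k & Ek); [lia|].
assert (Em : n * y * y = (k + x') * (k + x') - 37 * x' * x') by nia.
assert (Ok : Z.odd (n * y * y) = true).
{ rewrite !Z.odd_mul; apply Z.odd_spec in On, Oy; rewrite On, Oy; reflexivity. }
exists X, (3 * y), Z; split; [lia|split].
- destruct Oy as [j ->]; exists (3 * j + 1); lia.
(* [X] has the parity of [k], and [k] that of the odd number [n y^2]. *)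
- apply Z.odd_spec.
  replace X with (k + 2 * (3 * k + 25 * x')) by lia.
  rewrite Em in Ok; revert Ok.
  replace ((k + x') * (k + x') - 37 * x' * x') with (k * k + 2 * (k * x' - 18 * x' * x')) by ring.
  rewrite !Z.odd_add, !(Z.odd_mul 2), Z.odd_mul; simpl.
  destruct (Z.odd k); auto.
Qed.

(** After division by [gcd g y] the cofactor [g'] is prime to [y'], so [g'^2] divides [n] and [g']
    is [1] or [-1]. *)
Lemma sqr_divide_squarefree n g y : squarefree n -> g <> 0 -> (g * g | n * (y * y)) -> (g | y).
Proof.
intros sf g0 (q & Eq).
assert (G0 : Z.gcd g y <> 0) by (rewrite Z.gcd_eq_0; tauto).
destruct (Z.gcd_divide_l g y) as (g' & Eg), (Z.gcd_divide_r g y) as (y' & Ey).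
assert (C : Z.gcd g' y' = 1).
{ replace g' with (g / Z.gcd g y); [replace y' with (y / Z.gcd g y)|].
  - apply Z.gcd_div_gcd; auto.
  - rewrite Ey at 1; apply Z.div_mul; auto.
  - rewrite Eg at 1; apply Z.div_mul; auto. }
set (h := Z.gcd g y) in *.
assert (E : n * (y' * y') = q * (g' * g')).
{ apply (Z.mul_reg_l _ _ (h * h)); [nia|]; rewrite Eg, Ey in Eq; lia. }
assert (D : (g' * g' | n)).
{ apply (Gauss _ (y' * y')); [exists q; lia|].
  apply Zgcd_1_rel_prime in C; apply rel_prime_sym.
  apply rel_prime_mult; apply rel_prime_sym; apply rel_prime_mult; exact C. }
apply sf in D.
assert (g' = 1 \/ g' = -1) as [-> | ->] by nia; rewrite Ey, Eg; [exists y'|exists (- y')]; ring.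
Qed.

(** Dividing a solution with [x] odd by [gcd x z] makes it primitive, and a choice of sign gives
    [x = 3] mod [4], as [twist_w_everywhere_good] requires. *)
Lemma norm37_good_field n : 0 < n -> squarefree n -> n mod 4 = 3 -> ~ (37 | n) -> norm37 n ->
  good_field (- 37 * n).
Proof.
intros n0 sf n4 n37 R.
assert (On : Z.Odd n).
{ exists (2 * (n / 4) + 1); assert (E := Z.div_mod n 4); lia. }
split; [lia|split].
- intros k D.
  assert (nk : ~ (37 | k)).
  { intros (j & ->); destruct D as (q & E); apply n37; exists (- q * j * j); lia. }
  apply sf; apply (Gauss _ (-37)); [exact D|].
  apply rel_prime_sym, rel_prime_mult; apply rel_prime_sym, rel_prime_sym;
    apply (rel_prime_div 37); try (exists (-1); reflexivity);
    apply prime_rel_prime; auto using prime_37.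
- destruct (norm37_odd n On R) as (x & y & z & E & Oy & Ox).
  assert (Hx : x <> 0) by (destruct Ox; lia).
  assert (G0 : Z.gcd x z <> 0) by (rewrite Z.gcd_eq_0; tauto).
  destruct (Z.gcd_divide_l x z) as (x' & Ex), (Z.gcd_divide_r x z) as (z' & Ez).
  assert (C : Z.gcd x' z' = 1).
  { replace x' with (x / Z.gcd x z); [replace z' with (z / Z.gcd x z)|].
    - apply Z.gcd_div_gcd; auto.
    - rewrite Ez at 1; apply Z.div_mul; auto.
    - rewrite Ex at 1; apply Z.div_mul; auto. }
  set (g := Z.gcd x z) in *.
  assert (Og : Z.odd g = true).
  { apply Z.odd_spec in Ox; rewrite Ex, Z.odd_mul in Ox.
    apply andb_prop in Ox; apply Ox. }
  (* [g^2] divides [z^2 - 37 x^2 = n (2 y)^2]; oddness of [g] then removes the [2]. *)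
  assert (D : (g | 2 * y)).
  { apply (sqr_divide_squarefree n); auto.
    exists (z' * z' - 37 * x' * x'); rewrite Ex, Ez in E; lia. }
  assert (Dy : (g | y)).
  { apply (Gauss _ 2); auto; apply Z.odd_spec in Og; destruct Og as [j Ej].
    apply Zgcd_1_rel_prime; rewrite Ej.
    apply Zgcd_1_rel_prime, bezout_rel_prime; apply (Bezout_intro _ _ _ 1 (- j)); ring. }
  destruct Dy as (y' & Ey).
  assert (E' : 4 * n * y' * y' = z' * z' - 37 * x' * x').
  { apply (Z.mul_reg_l _ _ (g * g)); [nia|]; rewrite Ex, Ey, Ez in E; lia. }
  assert (Oy' : Z.Odd y').
  { apply Z.odd_spec; apply Z.odd_spec in Oy; rewrite Ey, Z.odd_mul in Oy.
    apply andb_prop in Oy; apply Oy. }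
  assert (Ox' : Z.odd x' = true).
  { apply Z.odd_spec in Ox; rewrite Ex, Z.odd_mul in Ox.
    apply andb_prop in Ox; apply Ox. }
  apply Z.odd_spec in Ox'.
  assert (S : exists x'', (x'' = x' \/ x'' = - x') /\ x'' mod 4 = 3).
  { assert (M : x' mod 4 = 3 \/ (- x') mod 4 = 3)
      by (destruct Ox' as [j ->]; Z.to_euclidean_division_equations; lia).
    destruct M; [exists x'|exists (- x')]; auto. }
  destruct S as (x'' & Sx & Mx).
  (* For [n = 4 q + 3] one has [-37 n = 4 (-37 q - 28) + 1]. *)
  apply (twist_w_everywhere_good (- 37 * n) ltac:(lia) (- 37 * (n / 4) - 28)) with
    (n := n) (x := x'') (y := y') (z := z'); auto.
  + assert (F := Z.div_mod n 4); lia.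
  + destruct Sx as [-> | ->]; lia.
  + destruct Sx as [-> | ->]; rewrite ?Z.gcd_opp_l; auto.
Qed.

End NormForm.

From mathcomp Require all_boot all_order all_fingroup all_algebra all_solvable all_field.
From Stdlib Require Reals.
From mathcomp Require Rstruct ring lra zify.

(** * Counting squarefree products of split primes *)

Module Counting.

Import all_boot all_order all_fingroup all_algebra all_solvable all_field.
Import Rstruct ring lra zify.
Set Implicit Arguments. Unset Strict Implicit. Unset Printing Implicit Defensive.
Import Order.TTheory GRing.Theory Num.Theory.
Local Open Scope ring_scope.

(** * The quadratic character modulo [37] and its Gauss sum *)

Definition squares37 := [:: 1; 3; 4; 7; 9; 10; 11; 12; 16; 21; 25; 26; 27; 28; 30; 33; 34; 36]%N.

(** The Legendre symbol modulo [37], read off a table so that its identities can be checked by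
    computation on residues. *)
Definition chi (n : nat) : int :=
  if (n %% 37 == 0)%N then 0 else if (n %% 37)%N \in squares37 then 1 else -1.

Lemma chi_mod n : chi (n %% 37) = chi n.
Proof. by rewrite /chi modn_mod. Qed.

Lemma forall_mod37 (P : pred nat) : all P (iota 0 37) -> forall n, P (n %% 37)%N.
Proof. by move=> /allP allP n; apply: allP; rewrite mem_iota ltn_mod. Qed.

Lemma chiM m n : chi (m * n) = chi m * chi n.
Proof.
rewrite -chi_mod -modnMm chi_mod -(chi_mod m) -(chi_mod n).
apply/eqP; move: m n.
suff H m : forall n, chi (m %% 37 * (n %% 37)) == chi (m %% 37) * chi (n %% 37) by move=> m; apply: H.
apply: (@forall_mod37 (fun n => chi (m %% 37 * n) == chi (m %% 37) * chi n)); move: m.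
apply: (@forall_mod37 (fun m => all (fun n => chi (m * n) == chi m * chi n) (iota 0 37))).
by vm_compute.
Qed.

(** The coefficients of the square of the Gauss sum. Adding [37] keeps the truncated subtraction
    exact. *)
Lemma chi_sqr_sum c :
  (\sum_(i < 37) chi i * chi (c + 37 - i)%N)%R = (if (c %% 37 == 0)%N then 36 else -1).
Proof.
transitivity (\sum_(i < 37) chi i * chi (c %% 37 + 37 - i)%N).
  apply: eq_bigr => i _; congr (_ * _); rewrite -chi_mod -[RHS]chi_mod; congr chi.
  have li : (i <= 37)%N := ltnW (ltn_ord i).
  by rewrite -!addnBA // modnDml.
rewrite -(big_mkord xpredT (fun i => chi i * chi (c %% 37 + 37 - i)%N)).
apply/eqP; move: c.
apply: (@forall_mod37 (fun c => \sum_(0 <= i < 37) chi i * chi (c + 37 - i)%N ==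
  if c == 0%N then 36 else -1)).
by rewrite unlock; vm_compute.
Qed.

(** By this the unit group of the field with [p ^ 36] elements has an element of order [37]. *)
Lemma dvdn_expn36 p : coprime p 37 -> (37 %| p ^ 36 - 1)%N.
Proof.
move=> cop; have := Euler_exp_totient cop.
rewrite (_ : totient 37 = 36%N) // => H.
rewrite -eqn_mod_dvd ?expn_gt0 //; first by apply/eqP.
by case: p cop {H} => //; rewrite /coprime gcd0n.
Qed.

(** The Gauss sum [g = sum_i chi(i) z^i] over a primitive 37th root of unity [z]
    of characteristic [p] satisfies [g^2 = 37], and the Frobenius fixes it when
    [chi p = 1]. *)
Lemma gauss_sum (F : finFieldType) (p : nat) (z : F) :
  p \in [pchar F] -> z != 1 -> z ^+ 37 = 1 -> chi p = 1 ->
  exists g : F, g ^+ 2 = 37%:R /\ g ^+ p = g.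
Proof.
move=> charFp z1 z37 chip.
have zmod k : z ^+ (k %% 37) = z ^+ k by rewrite expr_mod.
pose g := \sum_(i < 37) (chi i)%:~R * z ^+ i; exists g; split.
- have sumz : \sum_(i < 37) z ^+ i = 0.
    apply: (mulfI (x := z - 1)); first by rewrite subr_eq0.
    by rewrite -subrX1 z37 subrr mulr0.
  transitivity (\sum_(c < 37) (\sum_(i < 37) chi i * chi (c + 37 - i)%N)%:~R * z ^+ c).
    rewrite expr2 /g big_distrl /=.
    transitivity (\sum_(i < 37) \sum_(c < 37)
      (chi i)%:~R * (chi (c + 37 - i)%N)%:~R * z ^+ c).
      apply: eq_bigr => i _; rewrite big_distrr /=.
      rewrite (reindex_inj (h := fun c : 'I_37 => c - i)); last by move=> a b /addIr.
      apply: eq_bigr => c _.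
      have li : (i <= 37)%N := ltnW (ltn_ord i).
      have -> : nat_of_ord (c - i) = ((c + 37 - i) %% 37)%N.
        by rewrite /= modnDmr addnBA.
      rewrite chi_mod mulrACA -exprD -[z ^+ (_ + _)]zmod modnDmr -addnBA // addnCA subnKC //.
      by rewrite modnDr zmod.
    rewrite exchange_big /=; apply: eq_bigr => c _.
    by rewrite rmorph_sum /= big_distrl /=; apply: eq_bigr => i _; rewrite rmorphM.
  (* [chi_sqr_sum] reads [37 [c = 0] - 1]; the [-1] multiplies the sum of all [z ^ c], which
     vanishes. *)
  transitivity (\sum_(c < 37) ((if c == 0 :> nat then 37 else 0) * z ^+ c - z ^+ c)).
    apply: eq_bigr => c _; rewrite chi_sqr_sum modn_small //; case: eqP => _.
      by rewrite -[X in _ = _ - X]mul1r -mulrBl; congr (_ * _); rewrite -[1]/(1%:R) -natrB.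
    by rewrite mul0r sub0r mulrN1z mulN1r.
  rewrite big_split /= sumrN sumz subr0 big_ord_recl /= mulr1 big1 ?addr0 // => i _.
  by rewrite mul0r.
- rewrite -(pFrobenius_autE charFp) /g rmorph_sum /=.
  (* Multiplication by [p] permutes the residues modulo [37], and [chi (i * p) = chi i]. *)
  have p37 : coprime 37 p.
    rewrite prime_coprime //; apply/negP => d37; move: chip.
    by rewrite /chi (eqP (d37 : p %% 37 == 0)%N).
  have injp : injective (fun i : 'I_37 => inord ((i * p) %% 37) : 'I_37).
    move=> i j /(congr1 val); rewrite /= !inordK ?ltn_mod // => /eqP.
    move=> E; apply/val_inj/eqP; move: E.
    wlog le_ij : i j / (i <= j)%N.
      by case: (leqP i j) => [h /(_ i j h)//|/ltnW h /(_ j i h) H]; rewrite eq_sym => /H; rewrite eq_sym.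
    rewrite eq_sym eqn_mod_dvd ?leq_mul // -mulnBl Gauss_dvdl // => /dvdn_leq.
    have : (j - i < 37)%N by rewrite (leq_ltn_trans (leq_subr _ _)).
    case: posnP => [/eqP|pos lt37 /(_ isT)]; last by rewrite leqNgt lt37.
    by rewrite subn_eq0 => le_ji _ _; rewrite eqn_leq le_ij.
  rewrite [RHS](reindex_inj injp) /=; apply: eq_bigr => i _.
  rewrite inordK ?ltn_mod // chi_mod chiM chip mulr1 zmod rmorphM rmorph_int /=.
  by rewrite pFrobenius_autE exprM.
Qed.

(** The [p] images of [0, ..., p - 1] are roots of [X^p - X], and its degree leaves room for no
    other root. *)
Lemma frobenius_fixed (F : finFieldType) (p : nat) (g : F) :
  p \in [pchar F] -> g ^+ p = g -> exists k, g = k%:R.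
Proof.
move=> charFp gp; have prp := pcharf_prime charFp; have p1 := prime_gt1 prp.
pose s : seq F := [seq k%:R | k <- iota 0 p].
have [/mapP[k _ ->]|gNs] := boolP (g \in s); first by exists k.
have us : uniq s.
  rewrite map_inj_in_uniq ?iota_uniq // => i j; rewrite !mem_iota !add0n /=.
  wlog le_ij : i j / (i <= j)%N.
    by case: (leqP i j) => [h /(_ i j h)//|/ltnW h /(_ j i h) H] hi hj /esym/H->.
  move=> ip jp /esym/eqP; rewrite -subr_eq0 -natrB // -(dvdn_pcharf charFp) => /dvdn_leq.
  have : (j - i < p)%N by rewrite (leq_ltn_trans (leq_subr _ _)).
  case: posnP => [/eqP|pos ltp /(_ isT)]; last by rewrite leqNgt ltp.
  by rewrite subn_eq0 => le_ji _ _; apply/eqP; rewrite eqn_leq le_ij.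
have sizeq : size ('X^p - 'X : {poly F}) = p.+1.
  by rewrite size_polyDl size_polyXn // size_polyN size_polyX ltnS.
have := @max_poly_roots _ ('X^p - 'X) (g :: s).
rewrite sizeq /= size_map size_iota ltnn gNs us -size_poly_eq0 sizeq => H.
suff: false by []; apply: H => //.
apply/andP; split; first by rewrite rootE !hornerE gp subrr.
apply/allP => _ /mapP[k _ ->].
by rewrite rootE !hornerE -(pFrobenius_autE charFp) rmorph_nat subrr.
Qed.

(** The Gauss sum in the field with [p ^ 36] elements is a square root of [37] fixed by Frobenius,
    so it lies in the prime field. *)
Lemma chi_square_mod p : prime p -> chi p = 1 -> exists a, (p %| a ^ 2 - 37)%N /\ (37 <= a ^ 2)%N.
Proof.
move=> prp chip.
have [F charFp cardF] := @PrimePowerField p 36 prp isT.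
have p37 : coprime p 37.
  rewrite prime_coprime // dvdn_prime2 //; apply/eqP => p37; move: chip.
  by rewrite p37.
have [x _ ox] : {x : {unit F} | x \in [set: {unit F}]%G & #[x]%g = 37%N}.
  apply: Cauchy => //; rewrite card_finField_unit cardF -subn1.
  exact: dvdn_expn36.
have x37 : (val x) ^+ 37 = 1 by rewrite -FinRing.val_unitX -ox expg_order.
have x1 : val x != 1.
  apply/eqP => E; have : x = 1%g by apply: val_inj.
  by move=> E1; move: ox; rewrite E1 order1.
have [g [g2 gp]] := gauss_sum charFp x1 x37 chip.
have [k gk] := frobenius_fixed charFp gp.
(* Adding [7 p] keeps the residue and forces [a ^ 2 >= 37], so the truncated [a ^ 2 - 37] is a true
   difference. *)
have le37 : (37 <= (k + 7 * p) ^ 2)%N.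
  apply: (@leq_trans ((7 * 1) ^ 2)) => //; rewrite leq_exp2r //.
  by apply: leq_trans (leq_addl _ _); rewrite leq_mul2l /= prime_gt0.
exists (k + 7 * p)%N; split => //.
rewrite (dvdn_pcharf charFp) natrB // natrX natrD natrM (pcharf0 charFp) mulr0 addr0.
by rewrite -gk g2 subrr.
Qed.

(** * Logarithms of natural numbers *)

Notation R := Rdefinitions.R.
Notation ln := Rpower.ln.
Notation lg n := (ln (n%:R : R)).
Notation chiR n := ((chi n)%:~R : R).

Lemma lnM (x y : R) : 0 < x -> 0 < y -> ln (x * y) = ln x + ln y.
Proof. by move=> /RltP x0 /RltP y0; apply: Rpower.ln_mult. Qed.

Lemma ln1 : ln 1 = 0 :> R.
Proof. exact: Rpower.ln_1. Qed.

Lemma ler_ln (x y : R) : 0 < x -> x <= y -> ln x <= ln y.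
Proof.
move=> x0; rewrite le_eqVlt => /orP[/eqP->//|xy].
by apply/ltW/RltP/Rpower.ln_increasing; apply/RltP.
Qed.

Lemma lnV (x : R) : 0 < x -> ln x^-1 = - ln x.
Proof. by move=> /RltP x0; apply: Rpower.ln_Rinv. Qed.

Lemma ln_div (x y : R) : 0 < x -> 0 < y -> ln (x / y) = ln x - ln y.
Proof. by move=> x0 y0; rewrite lnM ?invr_gt0 // lnV. Qed.

Lemma ln_le_sub1 (x : R) : 0 < x -> ln x <= x - 1.
Proof.
move=> x0; have := Rpower.exp_ineq1_le (ln x).
rewrite Rpower.exp_ln; last exact/RltP.
by move/RleP; rewrite RplusE R1E => H; lra.
Qed.

(** [ln] takes the default value [0] off the positive reals. *)
Lemma lg0 : lg 0 = 0.
Proof.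
rewrite /Rpower.ln; case: RIneq.Rlt_dec => // h.
by exfalso; exact: (RIneq.Rlt_irrefl _ h).
Qed.

Lemma lg_ge0 n : 0 <= lg n.
Proof. by case: n => [|n]; rewrite ?lg0 // -ln1 ler_ln // ler1n. Qed.

Lemma lgM m n : (0 < m)%N -> (0 < n)%N -> lg (m * n) = lg m + lg n.
Proof. by move=> m0 n0; rewrite natrM lnM // ltr0n. Qed.

Lemma ler_lg m n : (0 < m)%N -> (m <= n)%N -> lg m <= lg n.
Proof. by move=> m0 mn; rewrite ler_ln ?ltr0n // ler_nat. Qed.

Lemma lg_exp n k : (0 < n)%N -> lg (n ^ k) = k%:R * lg n.
Proof.
move=> n0; elim: k => [|k IH]; first by rewrite expn0 ln1 mul0r.
by rewrite expnS lgM ?expn_gt0 ?n0 // IH -natr1 mulrDl mul1r addrC.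
Qed.

Lemma lg_le_sub1 n : (0 < n)%N -> lg n <= n%:R - 1.
Proof. by move=> n0; rewrite ln_le_sub1 // ltr0n. Qed.

Lemma lgS_le n : (0 < n)%N -> n%:R * (lg n.+1 - lg n) <= 1.
Proof.
move=> n0; have n0' : 0 < n%:R :> R by rewrite ltr0n.
rewrite -ln_div ?ltr0n // mulrC -ler_pdivlMr // div1r.
apply: le_trans (ln_le_sub1 _) _; first by rewrite divr_gt0 ?ltr0n.
by rewrite -natr1 mulrDl divff ?gt_eqF // mul1r addrC addKr.
Qed.

Lemma lg3_ge1 : 1 <= lg 3.
Proof.
rewrite -[X in X <= _](Rpower.ln_exp 1) ler_ln //; first by apply/RltP/Exp_prop.exp_pos.
by have /RleP := Rpower.exp_le_3; rewrite IZRposE INRE.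
Qed.

(** The decrease needs [lg n >= 1], whence the start at [3]. This is a monotone weight for partial
    summation. *)
Lemma lgS_div_le n : (2 < n)%N -> lg n.+1 / n.+1%:R <= lg n / n%:R.
Proof.
move=> n2; have n0 : (0 < n)%N by apply: leq_trans n2.
have n0' : 0 < n%:R :> R by rewrite ltr0n.
rewrite ler_pdivrMr ?ltr0n // mulrAC ler_pdivlMr //.
have := lgS_le n0; have : 1 <= lg n by apply: le_trans lg3_ge1 (ler_lg _ _).
by set L := lg n.+1; rewrite -natr1; nra.
Qed.

(** Sums over prime powers [p ^ k] with the von Mangoldt weight [lg p]; a cutoff
    [p ^ k <= N] is left to [g]. *)
Definition ppsum N (g : nat -> R) : R :=
  \sum_(1 <= p < N.+1 | prime p) \sum_(1 <= k < N.+1) lg p * g (p ^ k)%N.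

Lemma leq_ltn_expn N p : prime p -> (N < p ^ N.+1)%N.
Proof.
by move=> pp; apply: leq_trans (ltn_expl _ (prime_gt1 pp)) _; rewrite leq_exp2l ?prime_gt1.
Qed.

Lemma lg_prod (I : Type) (r : seq I) (P : pred I) (F : I -> nat) :
  (forall i, P i -> (0 < F i)%N) ->
  lg (\prod_(i <- r | P i) F i)%N = \sum_(i <- r | P i) lg (F i).
Proof.
move=> F0.
suff [] : lg (\prod_(i <- r | P i) F i)%N = \sum_(i <- r | P i) lg (F i) /\
  (0 < \prod_(i <- r | P i) F i)%N by [].
elim/big_rec2: _ => [|i x y Pi [IH x0]]; first by rewrite ln1.
by rewrite lgM ?F0 // IH muln_gt0 F0.
Qed.

(** The exponent of [p] in [n] counts the [k >= 1] with [p ^ k] dividing [n]; exponents [k >= n]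
    contribute nothing, since then [p ^ k > n]. *)
Lemma lg_ppsum n N : (0 < n <= N)%N -> lg n = ppsum N (fun q => (q %| n)%:R).
Proof.
move=> /andP[n0 nN]; rewrite /ppsum.
transitivity (\sum_(1 <= p < N.+1 | prime p) (logn p n)%:R * lg p).
  rewrite -[in LHS](partnT n0) (widen_partn _ nN).
  rewrite (eq_bigl xpredT) // big_ltn // lognE expn0 mul1n big_nat_cond lg_prod; last first.
    by move=> p /andP[/andP[p0 _] _]; rewrite expn_gt0 p0.
  rewrite -big_nat_cond [RHS]big_mkcond /= [LHS]big_nat [RHS]big_nat.
  apply: eq_bigr => p /andP[p0 _]; rewrite lg_exp //.
  by case: ifPn => // npp; rewrite lognE (negbTE npp) mul0r.
apply: eq_bigr => p pp; rewrite -big_distrr /= mulrC; congr (_ * _).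
rewrite -natr_sum; congr (_%:R); rewrite (logn_count_dvd _ pp).
rewrite (@big_cat_nat _ _ _ n 1 N.+1) //=; last exact: leqW.
rewrite [X in (_ + X)%N]big_nat [X in (_ + X)%N]big1 ?addn0 // => k /andP[nk _].
apply/eqP; rewrite eqb0; apply/negP => /dvdn_leq -/(_ n0); apply/negP; rewrite -ltnNge.
by apply: leq_trans (ltn_expl n (prime_gt1 pp)) _; rewrite leq_exp2l ?prime_gt1.
Qed.

Lemma ppsumE N g h : (forall q, (1 < q)%N -> g q = h q) -> ppsum N g = ppsum N h.
Proof.
move=> gh; rewrite /ppsum; apply: eq_bigr => p pp; rewrite !big_nat; apply: eq_bigr => k /andP[k0 _].
by rewrite gh // -(exp1n k) ltn_exp2r ?prime_gt1.
Qed.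

Lemma ler_ppsum N g h : (forall q, (1 < q)%N -> g q <= h q) -> ppsum N g <= ppsum N h.
Proof.
move=> gh; rewrite /ppsum; apply: ler_sum => p pp; rewrite !big_nat; apply: ler_sum => k /andP[k0 _].
by rewrite ler_wpM2l ?lg_ge0 // gh // -(exp1n k) ltn_exp2r ?prime_gt1.
Qed.

Lemma ppsumD N g h : ppsum N (fun q => g q + h q) = ppsum N g + ppsum N h.
Proof.
rewrite /ppsum -big_split; apply: eq_bigr => p _; rewrite -big_split; apply: eq_bigr => k _.
by rewrite mulrDr.
Qed.

Lemma ppsumZ N c g : ppsum N (fun q => c * g q) = c * ppsum N g.
Proof.
rewrite /ppsum big_distrr; apply: eq_bigr => p _; rewrite big_distrr; apply: eq_bigr => k _.
by rewrite mulrCA.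
Qed.

Lemma ppsum_norm N g : `|ppsum N g| <= ppsum N (fun q => `|g q|).
Proof.
apply: le_trans (ler_norm_sum _ _ _) _; apply: ler_sum => p _.
apply: le_trans (ler_norm_sum _ _ _) _; apply: ler_sum => k _.
by rewrite normrM (ger0_norm (lg_ge0 p)).
Qed.

(** A prime power [p ^ k] exceeds [M] as soon as [p] or [k] does. *)
Lemma ppsum_widen M N g : (M <= N)%N -> (forall q, (M < q)%N -> g q = 0) ->
  ppsum N g = ppsum M g.
Proof.
move=> MN g0; rewrite /ppsum.
have inner p : prime p -> \sum_(1 <= k < N.+1) lg p * g (p ^ k)%N =
    \sum_(1 <= k < M.+1) lg p * g (p ^ k)%N.
  move=> pp; rewrite (@big_cat_nat _ _ _ M.+1) //= [X in _ + X]big_nat [X in _ + X]big1 ?addr0 //.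
  move=> k /andP[Mk _]; rewrite g0 ?mulr0 //.
  by apply: leq_trans (leq_ltn_expn M pp) _; rewrite leq_exp2l ?prime_gt1.
rewrite (eq_bigr _ inner) (@big_cat_nat _ _ _ M.+1) //= [X in _ + X]big_nat_cond.
rewrite [X in _ + X]big1 ?addr0 // => p /andP[/andP[Mp _] pp].
rewrite big_nat big1 // => k /andP[k0 _]; rewrite g0 ?mulr0 //.
by apply: leq_trans Mp _; rewrite -[X in (X <= _)%N]expn1 leq_exp2l ?prime_gt1.
Qed.

Lemma sum_dvd N q (g : nat -> R) : (0 < q)%N ->
  \sum_(1 <= n < N.+1) g n * (q %| n)%:R = \sum_(1 <= m < (N %/ q).+1) g (q * m)%N.
Proof.
move=> q0; elim: N => [|N IH]; first by rewrite div0n !big_geq.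
rewrite big_nat_recr //= IH divnS //; case: dvdnP => [[m Em]|_]; last by rewrite mulr0 addr0 add0n.
rewrite /= mulr1n mulr1 add1n [RHS]big_nat_recr //=; congr (_ + g _).
have -> : (N %/ q).+1 = (N.+1 %/ q)%N by rewrite divnS // Em dvdn_mull.
by rewrite Em mulnK // mulnC.
Qed.

Lemma sum_lg_ppsum N (g : nat -> R) :
  \sum_(1 <= n < N.+1) g n * lg n = ppsum N (fun q => \sum_(1 <= m < (N %/ q).+1) g (q * m)%N).
Proof.
rewrite big_nat (eq_bigr (fun n => g n * ppsum N (fun q => (q %| n)%:R))); last first.
  by move=> n h; rewrite (@lg_ppsum n N).
rewrite -big_nat /ppsum.
transitivity (\sum_(1 <= n < N.+1) \sum_(1 <= p < N.+1 | prime p) \sum_(1 <= k < N.+1)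
    g n * (lg p * (p ^ k %| n)%:R)).
  by apply: eq_bigr => n _; rewrite big_distrr; apply: eq_bigr => p _; rewrite big_distrr.
rewrite exchange_big /=; apply: eq_bigr => p pp.
rewrite exchange_big /=; apply: eq_bigr => k _.
rewrite -sum_dvd ?expn_gt0 ?prime_gt0 // big_distrr; apply: eq_bigr => n _ /=.
by rewrite mulrCA.
Qed.

(** * Chebyshev and Mertens estimates over prime powers *)

Definition lgfact N : R := \sum_(1 <= n < N.+1) lg n.

(** Legendre's formula for the exponents in [N!]. *)
Lemma lgfact_ppsum N : lgfact N = ppsum N (fun q => (N %/ q)%:R).
Proof.
rewrite /lgfact; under eq_bigr do rewrite -[lg _]mul1r.
rewrite sum_lg_ppsum; apply: ppsumE => q _.
by rewrite big_const_nat subn1 /= iter_addr_0.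
Qed.

(** Stepping from [N] to [N + 2] brings in two factors, each at most [4 (N / 2 + 1)], and
    [lg 4 <= 3]. *)
Lemma lgfact_half N : lgfact N <= 3 * N%:R + 2 * lgfact (N %/ 2).
Proof.
have ln4 : lg 4 <= 3 by apply: le_trans (lg_le_sub1 _) _ => //; lra.
elim/ltn_ind: N => -[|[|N]] IH.
- by rewrite /lgfact big_geq // !mulr0 addr0.
- by rewrite /lgfact big_nat1 big_geq // ln1; lra.
have {}IH := IH N (leqnSn _).
have -> : (N.+2 %/ 2 = (N %/ 2).+1)%N by rewrite -addn2 divnDr // divnn /= addn1.
rewrite /lgfact big_nat_recr //= big_nat_recr //= -/(lgfact N).
rewrite [X in 2 * X]big_nat_recr //= -/(lgfact (N %/ 2)).
have h (m : nat) : (0 < m <= 4 * (N %/ 2).+1)%N -> lg m <= 3 + lg (N %/ 2).+1.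
  by move=> /andP[m0 hm]; apply: le_trans (ler_lg m0 hm) _; rewrite lgM // lerD2r.
have h1 : lg N.+1 <= 3 + lg (N %/ 2).+1 by apply: h; lia.
have h2 : lg N.+2 <= 3 + lg (N %/ 2).+1 by apply: h; lia.
have e : N.+2%:R = N%:R + 2 :> R by rewrite -natrD addn2.
by move: h1 h2; set a := lg N.+1; set b := lg N.+2; rewrite e; lra.
Qed.

Definition psi N : R := ppsum N (fun q => (q <= N)%:R).

(** Chebyshev's argument: for [N / 2 < q <= N] the integer quotients satisfy
    [N / q - 2 ((N / 2) / q) = 1], so [psi N <= 3 N + psi (N / 2)]. *)
Lemma psi_le N : psi N <= 6 * N%:R.
Proof.
elim/ltn_ind: N => -[|N] IH; first by rewrite /psi /ppsum big_geq // mulr0.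
set M := N.+1; have hM : (M %/ 2 < M)%N by rewrite ltn_Pdiv.
have {}IH := IH _ hM.
have D : psi M <= lgfact M - 2 * lgfact (M %/ 2) + psi (M %/ 2).
  rewrite !lgfact_ppsum /psi -(ppsum_widen (ltnW hM)); last first.
    by move=> q hq; rewrite divn_small.
  rewrite -(ppsum_widen (ltnW hM)); last by move=> q hq; rewrite leqNgt hq.
  rewrite -mulNr -ppsumZ -!ppsumD; apply: ler_ppsum => q q1.
  have : ((q <= M) + 2 * (M %/ 2 %/ q) <= M %/ q + (q <= M %/ 2))%N.
    rewrite divnAC; case: (leqP q M) => [qM|_]; last by lia.
    case: (leqP q (M %/ 2)) => qM2; first by lia.
    have -> : (M %/ q = 1)%N.
      by rewrite -(subnK qM) divnDr // divnn (ltnW q1) divn_small //; lia.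
    by [].
  rewrite -(ler_nat R) !natrD. lra.
have := lgfact_half M.
have : (M %/ 2)%:R * 2 <= M%:R :> R by rewrite -natrM ler_nat; lia.
lra.
Qed.

Lemma lgfact_le N : lgfact N <= N%:R * lg N.
Proof.
case: N => [|N]; first by rewrite /lgfact big_geq // mul0r.
rewrite /lgfact -[N.+1 in X in _ <= X * _]subn0.
apply: (@le_trans _ _ (\sum_(1 <= n < N.+2) lg N.+1)).
  by rewrite !big_nat; apply: ler_sum => n /andP[n0 nN]; rewrite ler_lg.
by rewrite big_const_nat iter_addr_0 subn1 subn0 mulr_natl.
Qed.

Lemma lgfact_ge N : N%:R * lg N - N%:R <= lgfact N.
Proof.
elim: N => [|N IH]; first by rewrite /lgfact big_geq // mul0r subr0.
rewrite /lgfact big_nat_recr //= -/(lgfact N).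
case: N IH => [|N] IH; first by rewrite ln1 mulr0 addr0 /lgfact big_geq //; lra.
have := lgS_le (ltn0Sn N); move: IH.
set a := lg N.+2; rewrite -(natr1 N.+1); lra.
Qed.

(** [N] times the sum exceeds [lgfact N] by at most [psi N], since a quotient [N / q] exceeds its
    integer part by less than [1]. *)
Lemma mertens_ppsum N : (0 < N)%N ->
  lg N - 1 <= ppsum N (fun q => (q <= N)%:R / q%:R) <= lg N + 6.
Proof.
move=> N0; have N0' : 0 < N%:R :> R by rewrite ltr0n.
set T := ppsum _ _.
have up : lgfact N <= N%:R * T.
  rewrite lgfact_ppsum /T -ppsumZ; apply: ler_ppsum => q q1.
  have q0 : 0 < q%:R :> R by rewrite ltr0n ltnW.
  case: leqP => qN; last by rewrite divn_small // mul0r mulr0.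
  by rewrite /= mul1r ler_pdivlMr // -natrM ler_nat leq_trunc_div.
have lo : N%:R * T <= lgfact N + psi N.
  rewrite lgfact_ppsum /T /psi -ppsumZ -ppsumD; apply: ler_ppsum => q q1.
  have q0 : 0 < q%:R :> R by rewrite ltr0n ltnW.
  case: leqP => qN; last by rewrite divn_small // mul0r mulr0 addr0.
  rewrite /= mul1r ler_pdivrMr // -natrD -natrM ler_nat addn1.
  exact/ltnW/ltn_ceil/ltnW.
have := lgfact_ge N; have := lgfact_le N; have := psi_le N => h1 h2 h3.
by apply/andP; split; rewrite -(ler_pM2l N0'); lra.
Qed.

(** * Partial summation *)

Lemma abel (a b : nat -> R) (C : R) m :
  (forall n, (m <= n)%N -> 0 <= b n) ->
  (forall n, (m <= n)%N -> b n.+1 <= b n) ->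
  (forall n, (m <= n)%N -> \sum_(m <= i < n) a i <= C) ->
  forall n, (m <= n)%N -> \sum_(m <= i < n) a i * b i <= C * b m.
Proof.
move=> b0 bdec aC n mn.
(* Summation by parts as an invariant: a boundary term plus [C] times the total decrease of [b] so
   far. *)
have H k : \sum_(m <= i < m + k) a i * b i <=
    (\sum_(m <= i < m + k) a i) * b (m + k)%N + C * (b m - b (m + k)%N).
  elim: k => [|k IH]; first by rewrite addn0 !big_geq // mul0r subrr mulr0 addr0.
  rewrite addnS !big_nat_recr ?leq_addr //=.
  have := aC (m + k).+1 (leqW (leq_addr _ _)); rewrite big_nat_recr ?leq_addr //=.
  have := bdec (m + k)%N (leq_addr _ _); move: IH.
  set A := \sum_(_ <= i < _) a i; set S := \sum_(_ <= i < _) _; nra.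
have := H (n - m)%N; rewrite subnKC // => {}H; apply: le_trans H _.
have := aC n mn; have := b0 n mn; nra.
Qed.

Lemma abel_norm (a b : nat -> R) (C : R) m :
  (forall n, (m <= n)%N -> 0 <= b n) ->
  (forall n, (m <= n)%N -> b n.+1 <= b n) ->
  (forall n, (m <= n)%N -> `|\sum_(m <= i < n) a i| <= C) ->
  forall n, (m <= n)%N -> `|\sum_(m <= i < n) a i * b i| <= C * b m.
Proof.
move=> b0 bdec aC n mn; rewrite ler_norml; apply/andP; split.
  rewrite lerNl -sumrN; under eq_bigr do rewrite -mulNr.
  apply: abel => // k mk; rewrite sumrN; apply: le_trans (aC k mk).
  by rewrite ler_normr lexx orbT.
by apply: abel => // k mk; apply: le_trans (aC k mk); rewrite ler_normr lexx.
Qed.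

(** * Partial sums of [chi] and the value [L(1, chi)] *)

Lemma chiR_norm n : `|chiR n| <= 1.
Proof. by rewrite /chi; case: ifP => _; [rewrite normr0|case: ifP; rewrite ?mulrN1z ?normrN normr1]. Qed.

Lemma chi_sum_period n : \sum_(0 <= i < n) chi i = \sum_(0 <= i < n %% 37) chi i.
Proof.
rewrite {1}(divn_eq n 37); elim: (n %/ 37)%N => [|q IH]; first by rewrite mul0n add0n.
rewrite mulSn -addnA (@big_cat_nat _ _ _ 37) ?leq_addr //=.
rewrite (_ : \sum_(0 <= i < 37) chi i = 0); last by rewrite unlock; vm_compute.
rewrite add0r -{1}[37%N]add0n big_addn addKn -IH; apply: eq_bigr => i _.
by rewrite -chi_mod modnDr chi_mod.
Qed.

Lemma chi_sum_norm n : `|\sum_(0 <= i < n) chi i| <= 5.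
Proof.
rewrite chi_sum_period; move: n.
apply: (@forall_mod37 (fun r => `|\sum_(0 <= i < r) chi i| <= 5)).
by rewrite unlock; vm_compute.
Qed.

Lemma chiR_sum_norm m n : `|\sum_(m <= i < n) chiR i| <= 10.
Proof.
case: (leqP m n) => [mn|/ltnW nm]; last by rewrite big_geq // normr0.
rewrite -rmorph_sum -intr_norm (_ : 10 = (10 : int)%:~R) // ler_int.
have := chi_sum_norm n; have := chi_sum_norm m.
by rewrite (@big_cat_nat _ _ _ m 0 n) //= !ler_norml; set a := bigop _ _ _; set b := bigop _ _ _; lia.
Qed.

Definition Lsum N : R := \sum_(1 <= n < N.+1) chiR n / n%:R.

Lemma Lsum_tail M N : (M <= N)%N -> `|Lsum N - Lsum M| <= 10 / M.+1%:R.
Proof.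
move=> MN; rewrite /Lsum (@big_cat_nat _ _ _ M.+1 1 N.+1) //= addrAC subrr add0r.
apply: (@abel_norm (fun n => chiR n) (fun n => (n%:R)^-1)) => //.
- by move=> n Mn; rewrite invr_ge0.
- by move=> n Mn; rewrite lef_pV2 ?posrE ?ltr0n ?ler_nat //; apply: leq_trans Mn.
- by move=> n Mn; apply: chiR_sum_norm.
Qed.

(** An effective form of [L(1, chi) > 0]: the first [36] terms give at least [6 / 10], and the tail
    is at most [10 / 37]. *)
Lemma Lsum_lb N : (36 <= N)%N -> 1 / 4 <= Lsum N.
Proof.
move=> /Lsum_tail; rewrite ler_norml => /andP[h _].
have : 6 / 10 <= Lsum 36; last by lra.
rewrite /Lsum unlock /= /chi /=.
lra.
Qed.

Lemma chi_lg_sum_norm N : (3 <= N)%N -> `|\sum_(1 <= n < N.+1) chiR n / n%:R * lg n| <= 8.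
Proof.
(* The terms [n = 1, 2] are split off because [lg n / n] is shown to decrease only from [3] on. *)
move=> N3; rewrite (@big_cat_nat _ _ _ 3 1 N.+1) //=; last exact: ltnW.
have h1 : `|\sum_(1 <= n < 3) chiR n / n%:R * lg n| <= 1 / 2.
  rewrite unlock /= ln1 mulr0 add0r addr0 /chi /=.
  have : 0 <= lg 2 := lg_ge0 2; have : lg 2 <= 2 - 1 := lg_le_sub1 (isT : (0 < 2)%N).
  by rewrite ler_norml; lra.
have h2 : `|\sum_(3 <= n < N.+1) chiR n / n%:R * lg n| <= 10 * (lg 3 / 3%:R).
  under eq_bigr do rewrite mulrAC -mulrA.
  apply: (@abel_norm (fun n => chiR n) (fun n => lg n / n%:R)) => //.
  - by move=> n _; rewrite divr_ge0 ?lg_ge0.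
  - by move=> n n3; apply: lgS_div_le.
  - by move=> n _; apply: chiR_sum_norm.
  - exact: ltnW.
have h3 : lg 3 <= 3 - 1 := lg_le_sub1 (isT : (0 < 3)%N).
apply: le_trans (ler_normD _ _) _; lra.
Qed.

(** Expanding [lg n] turns the sum of [chi n * lg n / n] into a prime power sum with factors
    [Lsum (N / q)]. Replacing these by [Lsum N] costs at most [10 * psi N / N <= 60], and [8 + 60]
    divided by the lower bound [1 / 4] is [272]. *)
Lemma mertens_chi_ppsum N : (36 <= N)%N ->
  `|ppsum N (fun q => (q <= N)%:R * (chiR q / q%:R))| <= 272.
Proof.
move=> N36; set T := ppsum _ _.
have N0n : (0 < N)%N by lia.
have N0 : 0 < N%:R :> R by rewrite ltr0n.
have h1 := @chi_lg_sum_norm N (leq_trans (isT : 3 <= 36)%N N36).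
have h2 : `|\sum_(1 <= n < N.+1) chiR n / n%:R * lg n - Lsum N * T| <= 60.
  rewrite sum_lg_ppsum /T -mulNr -ppsumZ -ppsumD.
  apply: le_trans (ppsum_norm _ _) _.
  apply: (@le_trans _ _ (ppsum N (fun q => 10 / N%:R * (q <= N)%:R))); last first.
    rewrite ppsumZ -/(psi N); have := psi_le N => h.
    by rewrite mulrAC ler_pdivrMr //; lra.
  apply: ler_ppsum => q q1; have q0n := ltnW q1; have q0 : 0 < q%:R :> R by rewrite ltr0n ltnW.
  have -> : \sum_(1 <= m < (N %/ q).+1) chiR (q * m)%N / (q * m)%:R =
      chiR q / q%:R * Lsum (N %/ q).
    rewrite /Lsum big_distrr /=; apply: eq_bigr => m _.
    by rewrite chiM rmorphM natrM invfM mulrACA.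
  case: leqP => qN; last first.
    by rewrite divn_small // /Lsum big_geq // !(mulr0, mul0r) addr0 normr0.
  rewrite /= mulr1 mul1r mulNr [Lsum N * _]mulrC -mulrBr normrM distrC.
  have := Lsum_tail (leq_div N q); set D := `|_ - _| => hD.
  have D0 : 0 <= D by apply: normr_ge0.
  apply: (@le_trans _ _ (q%:R^-1 * (10 / (N %/ q).+1%:R))).
    apply: ler_pM => //.
    rewrite normrM [`|_^-1|]ger0_norm ?invr_ge0 ?ler0n //.
    by rewrite -[X in _ <= X]mul1r ler_wpM2r ?chiR_norm // invr_ge0 ler0n.
  rewrite mulrCA ler_pM2l // -invfM lef_pV2 ?posrE ?mulr_gt0 ?ltr0n //.
  by rewrite -natrM ler_nat mulnC; apply/ltnW/ltn_ceil/ltnW.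
have h3 := Lsum_lb N36.
have : `|Lsum N * T| <= 68.
  move: h1 h2; set S := bigop _ _ _; set P := _ * T => h1 h2.
  by rewrite -[P](subKr S); apply: le_trans (ler_normB _ _) _; lra.
have T0 := normr_ge0 T.
rewrite normrM ger0_norm; last by lra.
nra.
Qed.

(** The induction telescopes: each term is at most the decrease of [(lg n + 2) / n] from [n - 1] to
    [n]. *)
Lemma sum_lg_div_le N : (0 < N)%N ->
  \sum_(2 <= n < N.+1) lg n / (n * n.-1)%:R <= 2 - (lg N + 2) / N%:R.
Proof.
elim: N => // -[_ _|N IH _]; first by rewrite big_geq // ln1 add0r divr1 subrr.
have {}IH := IH isT; rewrite big_nat_recr //=; set M := N.+1 in IH *.
have M0 : 0 < M%:R :> R by rewrite ltr0n.
suff : lg M.+1 / (M.+1 * M)%:R <= (lg M + 2) / M%:R - (lg M.+1 + 2) / M.+1%:R.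
  by move=> h; apply: le_trans (lerD IH h) _; rewrite addrA subrK.
have h := lgS_le (ltn0Sn N); rewrite -/M in h.
have h' : lg M.+1 - lg M <= 1.
  apply: le_trans h; rewrite ler_peMl // ?ler1n // subr_ge0; exact: ler_lg.
have M1 : 0 < M.+1%:R :> R by rewrite ltr0n.
have e : M.+1%:R = M%:R + 1 :> R by rewrite natr1.
rewrite natrM; move: h h' M1; set a := lg M.+1; set b := lg M; rewrite e => h h' M1.
have -> : (b + 2) / M%:R - (a + 2) / (M%:R + 1) =
  ((b + 2) * (M%:R + 1) - (a + 2) * M%:R) / ((M%:R + 1) * M%:R).
  by field; lra.
rewrite ler_pM2r; last by rewrite invr_gt0 mulr_gt0.
nra.
Qed.

Lemma geom_le (x : R) n : 0 <= x < 1 -> \sum_(2 <= k < n) x ^+ k <= x ^+ 2 / (1 - x).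
Proof.
move=> /andP[x0 x1]; rewrite ler_pdivlMr ?subr_gt0 //.
case: (leqP n 2) => [n2|n2]; first by rewrite big_geq // mul0r exprn_ge0.
suff -> : (\sum_(2 <= k < n) x ^+ k) * (1 - x) = x ^+ 2 - x ^+ n.
  by rewrite gerBl exprn_ge0.
elim: n n2 => // n IH; rewrite ltnS leq_eqVlt => /orP[/eqP <-|n2].
  by rewrite big_nat1 exprS; ring.
by rewrite big_nat_recr 1?ltnW //= mulrDl IH // [x ^+ n.+1]exprS; ring.
Qed.

(** * Mertens estimates for split and inert primes *)

Definition psum N (c : nat -> R) : R := \sum_(1 <= p < N.+1 | prime p) c p * (lg p / p%:R).

(** By a geometric series the powers [k >= 2] of [p] contribute at most [lg p / (p (p - 1))]. *)
Lemma ppsum_psum N (c : nat -> R) : (forall n, `|c n| <= 1) ->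
  `|ppsum N (fun q => (q <= N)%:R * (c q / q%:R)) - psum N c| <= 2.
Proof.
move=> c1; case: N => [|N]; first by rewrite /ppsum /psum !big_geq // subrr normr0.
rewrite /ppsum /psum -sumrB.
apply: (@le_trans _ _ (\sum_(2 <= n < N.+2) lg n / (n * n.-1)%:R)); last first.
  apply: le_trans (@sum_lg_div_le N.+1 isT) _.
  by rewrite gerBl divr_ge0 // addr_ge0 // lg_ge0.
apply: le_trans (ler_norm_sum _ _ _) _.
rewrite big_ltn_cond //= big_mkcond /= !big_nat; apply: ler_sum => p /andP[p2 pN].
have p0 : 0 < p%:R :> R by rewrite ltr0n; apply: leq_trans p2.
have pm0 : 0 < p.-1%:R :> R by rewrite ltr0n; lia.
case: ifP => [pp|_]; last by rewrite divr_ge0 // lg_ge0.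
rewrite big_ltn // expn1 -ltnS pN mul1r addrAC mulrCA subrr add0r.
apply: le_trans (ler_norm_sum _ _ _) _.
have x1 : 0 <= (p%:R^-1 : R) < 1.
  by rewrite invr_ge0 ltW //= invf_lt1 // ltr1n prime_gt1.
apply: (@le_trans _ _ (lg p * \sum_(2 <= k < N.+2) p%:R^-1 ^+ k)).
  rewrite big_distrr /=; apply: ler_sum => k _.
  rewrite normrM (ger0_norm (lg_ge0 p)) ler_wpM2l ?lg_ge0 //.
  rewrite !normrM natrX exprVn [`|_^-1|]ger0_norm; last by rewrite invr_ge0 exprn_ge0 ?ltW.
  rewrite mulrA -[X in _ <= X]mul1r ler_wpM2r ?invr_ge0 ?exprn_ge0 //.
  by rewrite mulr_ile1 //; case: (_ <= _)%N; rewrite /= ?normr0 ?normr1.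
rewrite ler_wpM2l ?lg_ge0 //; apply: le_trans (geom_le _ x1) _.
have -> : p%:R = p.-1%:R + 1 :> R by rewrite natr1 prednK // ltnW.
rewrite natrM; have -> : p%:R = p.-1%:R + 1 :> R by rewrite natr1 prednK // ltnW.
by rewrite le_eqVlt; apply/orP; left; apply/eqP; field; rewrite !gt_eqF //; lra.
Qed.

Lemma psumD N a b : psum N (fun n => a n + b n) = psum N a + psum N b.
Proof. by rewrite /psum -big_split; apply: eq_bigr => p _; rewrite mulrDl. Qed.

Lemma psumZ N c a : psum N (fun n => c * a n) = c * psum N a.
Proof. by rewrite /psum big_distrr; apply: eq_bigr => p _; rewrite -mulrA. Qed.

Lemma lg_div_le1 n : 0 <= lg n / n%:R <= 1.
Proof.
rewrite divr_ge0 ?lg_ge0 //=; case: n => [|n]; first by rewrite lg0 mul0r.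
rewrite ler_pdivrMr ?ltr0n // mul1r; apply: le_trans (lg_le_sub1 (ltn0Sn n)) _.
by rewrite gerBl.
Qed.

Lemma psum_norm N a : (forall n, `|a n| <= 1) -> `|psum N a| <= N%:R.
Proof.
move=> a1; apply: le_trans (ler_norm_sum _ _ _) _.
apply: (@le_trans _ _ (\sum_(1 <= p < N.+1) 1)); last first.
  by rewrite big_const_nat iter_addr_0 subn1.
rewrite big_mkcond /=; apply: ler_sum => p _; case: ifP => // _.
rewrite normrM mulr_ile1 ?normr_ge0 //.
by have /andP[h0 h1] := lg_div_le1 p; rewrite ger0_norm.
Qed.

Lemma mertens N : (0 < N)%N -> lg N - 3 <= psum N (fun=> 1) <= lg N + 8.
Proof.
move=> N0; have := @ppsum_psum N (fun=> 1) (fun=> ltac:(by rewrite normr1)).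
have := mertens_ppsum N0.
rewrite (@ppsumE _ _ (fun q => (q <= N)%:R * (1 / q%:R))); last by move=> q _; rewrite mul1r.
by rewrite ler_norml => /andP[h1 h2] /andP[h3 h4]; apply/andP; split; lra.
Qed.

Lemma mertens_chi N : `|psum N (fun n => chiR n)| <= 274.
Proof.
case: (leqP 36 N) => [N36|N36].
  have := @ppsum_psum N (fun n => chiR n) chiR_norm; have := mertens_chi_ppsum N36.
  by rewrite !ler_norml => /andP[h1 h2] /andP[h3 h4]; apply/andP; split; lra.
apply: le_trans (psum_norm _ chiR_norm) _.
by apply: (@le_trans _ _ 36%:R); rewrite ler_nat // ltnW.
Qed.

Lemma psum_37 N : 0 <= psum N (fun n => (n == 37)%:R) <= 1.
Proof.
have e n : (n == 37)%:R * (lg n / n%:R) = if n == 37 then lg 37 / 37%:R else 0 :> R.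
  by case: eqP => [->|]; rewrite ?mul1r ?mul0r.
have /andP[h0 h1] := lg_div_le1 37.
have [/le_trans le0 le1] : 0 <= psum N (fun n => (n == 37)%:R) /\
    psum N (fun n => (n == 37)%:R) <= \sum_(1 <= p < N.+1) if p == 37 then lg 37 / 37%:R else 0.
  rewrite /psum; split.
    by apply: sumr_ge0 => p _; rewrite e; case: ifP.
  by rewrite big_mkcond; apply: ler_sum => p _; rewrite e; do 2!case: ifP.
rewrite le0 //=; apply: le_trans le1 _.
rewrite -big_mkcond -big_filter.
have : (size [seq i <- index_iota 1 N.+1 | i == 37] <= 1)%N.
  have := count_uniq_mem 37 (iota_uniq 1 (N.+1 - 1)).
  by rewrite size_filter => ->; case: (_ \in _).
by case: [seq _ <- _ | _] => [|a [|]] // _; rewrite ?big_nil ?big_seq1.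
Qed.

Definition inert : pred nat := fun p => prime p && (chi p == -1).
Definition split : pred nat := fun p => prime p && (chi p == 1).

Lemma chiR_cases n : prime n ->
  chiR n = (split n)%:R - (inert n)%:R /\ (split n)%:R + (inert n)%:R + (n == 37)%:R = 1 :> R.
Proof.
move=> pn; rewrite /split /inert pn /=.
have -> : (n == 37) = (n %% 37 == 0)%N by rewrite eq_sym -dvdn_prime2.
rewrite /chi; case: ifP => [_|n37]; first by rewrite /= ?subrr; split; lra.
by case: ifP => _ /=; split; rewrite ?mulrN1z; lra.
Qed.

(** Apart from the ramified prime [37], the two indicators are [(1 + chi) / 2] and
    [(1 - chi) / 2]. *)
Lemma psum_split_inert N : (0 < N)%N ->
  lg N / 2 - 140 <= psum N (fun n => (split n)%:R) <= lg N / 2 + 141 /\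
  psum N (fun n => (inert n)%:R) <= lg N / 2 + 141.
Proof.
move=> N0; have h1 := mertens N0; have h2 := mertens_chi N; have h3 := psum_37 N.
have e1 : psum N (fun n => chiR n) =
    psum N (fun n => (split n)%:R) - psum N (fun n => (inert n)%:R).
  rewrite -mulN1r -psumZ -psumD; apply: eq_bigr => p pp.
  by rewrite (chiR_cases pp).1 mulN1r.
have e2 : psum N (fun=> 1) = psum N (fun n => (split n)%:R) +
    psum N (fun n => (inert n)%:R) + psum N (fun n => (n == 37)%:R).
  by rewrite -!psumD; apply: eq_bigr => p pp; rewrite (chiR_cases pp).2.
move: h1 h2 h3; rewrite e1 e2 ler_norml.
by move=> /andP[? ?] /andP[? ?] /andP[? ?]; split; [apply/andP; split|]; lra.
Qed.

(** * Reciprocals of the inert primes *)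

Lemma lg2_ge : 1 / 2 <= lg 2.
Proof.
have : ln (2%:R^-1) <= 2%:R^-1 - 1 :> R by apply: ln_le_sub1; rewrite invr_gt0 ltr0n.
by rewrite lnV ?ltr0n //; lra.
Qed.

Definition harmonic N : R := \sum_(1 <= n < N.+1) n%:R^-1.

Lemma harmonic_ge N : lg N.+1 <= harmonic N.
Proof.
elim: N => [|N IH]; first by rewrite /harmonic big_geq // ln1.
rewrite /harmonic big_nat_recr //= -/(harmonic N).
have h := lgS_le (ltn0Sn N).
have h' : lg N.+2 - lg N.+1 <= N.+1%:R^-1.
  by rewrite -[X in _ <= X]mul1r ler_pdivlMr ?ltr0n // mulrC.
by have := lerD IH h'; rewrite subrKC.
Qed.

(** Comparison with the increments of [ln (lg n)]: [ln x <= x - 1] is used at [lg N / lg (N + 1)],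
    then at [N / (N + 1)]. The [2] absorbs the first term and [ln (lg 2) >= -1]. *)
Lemma sum_inv_lg_le N : (2 <= N)%N ->
  \sum_(2 <= n < N.+1) (n%:R * lg n)^-1 <= 2 + ln (lg N).
Proof.
have lnlg2 : -1 <= ln (lg 2).
  rewrite -lerN2 -lnV; last by have := lg2_ge; lra.
  have h := lg2_ge; apply: le_trans (ln_le_sub1 _) _; first by rewrite invr_gt0; lra.
  suff : (lg 2)^-1 <= 2 by lra.
  by rewrite -[X in _ <= X]invrK lef_pV2 ?posrE //; lra.
elim: N => // N IH; rewrite leq_eqVlt => /orP[/eqP <-|].
  rewrite big_nat1; apply: (@le_trans _ _ 1); last by lra.
  by rewrite invf_le1; have := lg2_ge; lra.
rewrite ltnS => N2; have {}IH := IH N2; rewrite big_nat_recr //=; last exact: leqW.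
have l0 n : (2 <= n)%N -> 0 < lg n.
  by move=> n2; have := lg2_ge; have := @ler_lg 2 n isT n2; lra.
have h1 : (N.+1%:R * lg N.+1)^-1 <= ln (lg N.+1) - ln (lg N).
  rewrite -opprB -ln_div ?l0 ?leqW //; rewrite lerNr.
  apply: le_trans (ln_le_sub1 _) _; first by rewrite divr_gt0 ?l0 // leqW.
  have L0 : 0 < lg N.+1 by rewrite l0 // leqW.
  have N0 : 0 < N.+1%:R :> R by rewrite ltr0n.
  suff : 1 / N.+1%:R <= lg N.+1 - lg N.
    move=> h; rewrite -(ler_pM2r L0) mulrBl mul1r divfK ?gt_eqF // mulNr invfM divfK ?gt_eqF //.
    by rewrite -lerN2 opprK opprB -div1r.
  rewrite -opprB -ln_div ?ltr0n //; last by apply: leq_trans N2.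
  rewrite lerNr; apply: le_trans (ln_le_sub1 _) _; first by rewrite divr_gt0 ?ltr0n //; lia.
  have e : N%:R = N.+1%:R - 1 :> R by rewrite -natr1 addrK.
  by rewrite e mulrBl divff ?gt_eqF // addrAC subrr add0r lexx.
by have := lerD IH h1; rewrite -addrA [ln (lg N) + _]addrC subrK.
Qed.

Lemma inert_recip_sum N : (2 <= N)%N ->
  \sum_(2 <= p < N.+1) (inert p)%:R / p%:R <= 300 + ln (lg N) / 2.
Proof.
move=> N2; have l0 n : (2 <= n)%N -> 0 < lg n.
  by move=> n2; have := lg2_ge; have := @ler_lg 2 n isT n2; lra.
(* Half the harmonic series balances the inert primes, so the partial sums of [a] are bounded above;
   the weight [1 / lg n] then gives reciprocals with main term half of [ln (lg N)]. *)
pose a n : R := (inert n)%:R * (lg n / n%:R) - 1 / 2 * n%:R^-1.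
have A : \sum_(2 <= n < N.+1) a n * (lg n)^-1 <= 142 * (lg 2)^-1.
  apply: (@abel a (fun n => (lg n)^-1)) => //; last exact: leqW.
  - by move=> n n2; rewrite invr_ge0 ltW // l0.
  - by move=> n n2; rewrite lef_pV2 ?posrE ?l0 ?leqW // ler_lg //; apply: leq_trans n2.
  move=> [//|[//|n]] _; rewrite /a sumrB -big_distrr /=.
  have [_ h1] := @psum_split_inert n.+1 isT.
  have h2 := harmonic_ge n.+1; have h3 : lg n.+1 <= lg n.+2 by apply: ler_lg.
  have -> : \sum_(2 <= i < n.+2) i%:R^-1 = harmonic n.+1 - 1 :> R.
    by rewrite /harmonic [in RHS]big_ltn //= invr1 addrC addKr.
  have -> : \sum_(2 <= i < n.+2) (inert i)%:R * (lg i / i%:R) =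
      psum n.+1 (fun n => (inert n)%:R).
    rewrite /psum [RHS]big_ltn_cond //= [RHS]big_mkcond /=; apply: eq_bigr => i _.
    by rewrite /inert; case: (prime i); rewrite ?mul0r.
  by lra.
have h2 : (lg 2)^-1 <= 2 by have := lg2_ge => h; rewrite -[X in _ <= X]invrK lef_pV2 ?posrE //; lra.
have h3 := sum_inv_lg_le N2.
have : \sum_(2 <= n < N.+1) a n * (lg n)^-1 = \sum_(2 <= p < N.+1) (inert p)%:R / p%:R -
    1 / 2 * \sum_(2 <= n < N.+1) (n%:R * lg n)^-1.
  rewrite big_distrr /= -sumrB !big_nat; apply: eq_bigr => n /andP[n2 _].
  rewrite /a mulrBl invfM -!mulrA; congr (_ * _ - _).
  by rewrite mulrCA mulrV ?mulr1 // unitfE gt_eqF // l0.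
lra.
Qed.

Lemma exp_le (a x : R) : 0 < x -> a <= ln x -> Rtrigo_def.exp a <= x.
Proof.
move=> /RltP x0 h; rewrite -[x in _ <= x]Rpower.exp_ln //; apply/RleP.
move: h; rewrite le_eqVlt => /orP[/eqP->|h]; first exact: RIneq.Rle_refl.
by apply/RIneq.Rlt_le/Rpower.exp_increasing/RltP.
Qed.

Lemma ln_sqrt (x : R) : 0 < x -> ln (Num.sqrt x) = ln x / 2.
Proof.
move=> x0; rewrite -[x in RHS]sqr_sqrtr ?ltW // expr2 lnM ?sqrtr_gt0 //; lra.
Qed.

Lemma ln_prod (I : eqType) (r : seq I) (F : I -> R) :
  {in r, forall i, 0 < F i} -> ln (\prod_(i <- r) F i) = \sum_(i <- r) ln (F i).
Proof.
move=> F0; suff [] : ln (\prod_(i <- r) F i) = \sum_(i <- r) ln (F i) /\ 0 < \prod_(i <- r) F i by [].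
rewrite !(big_seq _ _ r); elim/big_rec2: _ => [|i x y ri [IH x0]]; first by rewrite ln1.
by rewrite lnM ?F0 // IH mulr_gt0 ?F0.
Qed.

(** * The sieve for good integers *)

Definition Hs (A : pred nat) N : R := \sum_(1 <= n < N.+1) (A n)%:R / n%:R.

(** The multiples of [q] in [A] are [q m] with [m] in [A], so they carry at most [1 / q] of the
    sum. *)
Lemma Hs_remove (A : pred nat) q N : (0 < q)%N -> (forall n, A (q * n)%N -> A n) ->
  (1 - q%:R^-1) * Hs A N <= Hs (fun n => A n && ~~ (q %| n)%N) N.
Proof.
move=> q0 cA; have q0' : 0 < q%:R :> R by rewrite ltr0n.
suff : \sum_(1 <= n < N.+1) (A n)%:R / n%:R * (q %| n)%:R <= q%:R^-1 * Hs A N.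
  rewrite mulrBl mul1r lerBlDr addrC => h; apply: le_trans (lerD h (lexx _)).
  rewrite /Hs -big_split le_eqVlt; apply/orP; left; apply/eqP; apply: eq_bigr => n _ /=.
  by case: (A n); case: (q %| n)%N; rewrite /= ?mul0r ?mulr0 ?mulr1 ?addr0 ?add0r.
rewrite sum_dvd // big_distrr /=.
apply: (@le_trans _ _ (\sum_(1 <= m < (N %/ q).+1) q%:R^-1 * ((A m)%:R / m%:R))).
  apply: ler_sum => m _; rewrite natrM invfM mulrCA ler_wpM2l ?invr_ge0 ?ler0n //.
  rewrite ler_wpM2r ?invr_ge0 ?ler0n // ler_nat.
  by case: (boolP (A (q * m)%N)) => // /cA ->.
rewrite (@big_cat_nat _ _ _ (N %/ q).+1 1 N.+1) //=; last by rewrite ltnS leq_div.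
by rewrite lerDl sumr_ge0 // => i _; rewrite mulr_ge0 ?divr_ge0 ?invr_ge0 ?ler0n.
Qed.

Lemma Hs_sieve (qs : seq nat) N : all (leq 1) qs ->
  \prod_(q <- qs) (1 - q%:R^-1) * harmonic N <= Hs (fun n => all (fun q => ~~ (q %| n)%N) qs) N.
Proof.
elim: qs => [_|q qs IH /andP[q0 /IH {}IH]].
  by rewrite big_nil mul1r /harmonic /Hs; under [X in _ <= X]eq_bigr do rewrite div1r.
rewrite big_cons -mulrA.
apply: le_trans (ler_wpM2l _ IH) _.
  by rewrite subr_ge0 invf_le1 ?ler1n ?ltr0n.
apply: le_trans (Hs_remove _ q0 _) _.
  move=> n /allP h; apply/allP => r /h; apply: contra => rn; exact: dvdn_mull.
by rewrite le_eqVlt; apply/orP; left; apply/eqP/eq_bigr => n _; rewrite /= andbC.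
Qed.

(** The squarefree products of split primes, with [3] kept out so that it can be multiplied in
    later. *)
Definition good (n : nat) : bool :=
  (0 < n)%N && all (fun p => [&& chi p == 1, p != 3 & logn p n == 1%N]) (primes n).

(** All squares [l ^ 2] are listed, not only those of primes, so that the product of the
    [1 - 1 / l^2] telescopes. *)
Definition sieving N : seq nat :=
  [:: 3; 37] ++ [seq (l ^ 2)%N | l <- index_iota 2 N.+1] ++ [seq p <- index_iota 2 N.+1 | inert p].

Lemma sieving_good N n : (0 < n <= N)%N -> all (fun q => ~~ (q %| n)%N) (sieving N) -> good n.
Proof.
move=> /andP[n0 nN] /allP h; rewrite /good n0 /=; apply/allP => p.
rewrite mem_primes => /and3P[pp _ pn].
have pN : (2 <= p < N.+1)%N by rewrite prime_gt1 // ltnS (leq_trans _ nN) // dvdn_leq.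
have pNs : p \notin sieving N by apply/negP => /h; rewrite pn.
have p2Ns : (p ^ 2)%N \in sieving N by
  rewrite !mem_cat (map_f (fun l => (l ^ 2)%N)) ?orbT // mem_index_iota.
move: pNs; rewrite /sieving !mem_cat !negb_or mem_filter mem_index_iota pN andbT /inert pp.
move=> /and3P[/and3P[-> p37 _] _ /= chi1]; apply/andP; split.
  move: chi1; rewrite /chi.
  rewrite -[(p %% 37 == 0)%N]/(37 %| p)%N dvdn_prime2 // [37 == p]eq_sym (negbTE p37).
  by case: ifP.
have lp : (0 < logn p n)%N by rewrite logn_gt0 mem_primes pp n0.
rewrite eqn_leq lp andbT leqNgt.
by apply/negP => l2; move: (h _ p2Ns); rewrite pfactor_dvdn // l2.
Qed.

(** For [N >= 1] the product telescopes to [(N + 1) / (2 N)]. *)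
Lemma prod_inv_sqr_ge N : 1 / 2 <= \prod_(2 <= l < N.+1) (1 - (l ^ 2)%:R^-1) :> R.
Proof.
suff h n : \prod_(2 <= l < n.+2) (1 - (l ^ 2)%:R^-1) = n.+2%:R / (n.+1%:R * 2) :> R.
  case: N => [|n]; first by rewrite big_geq //; lra.
  rewrite h ler_pdivlMr ?mulr_gt0 ?ltr0n //.
  by have : n.+1%:R <= n.+2%:R :> R; [rewrite ler_nat|lra].
elim: n => [|n IH]; first by rewrite big_geq // mul1r divff // pnatr_eq0.
rewrite big_nat_recr //= IH natrX.
have h : 0 <= n%:R :> R by rewrite ler0n.
have -> : n.+3%:R = n%:R + 3 :> R by rewrite -natrD addn3.
have -> : n.+2%:R = n%:R + 2 :> R by rewrite -natrD addn2.
have -> : n.+1%:R = n%:R + 1 :> R by rewrite natr1.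
by field; lra.
Qed.

Lemma sum_inv_pronic_le N : \sum_(2 <= n < N.+1) (n * n.-1)%:R^-1 <= 1 :> R.
Proof.
suff h n : \sum_(2 <= n < n.+2) (n * n.-1)%:R^-1 = 1 - n.+1%:R^-1 :> R.
  case: N => [|n]; first by rewrite big_geq.
  by rewrite h gerBl invr_ge0.
elim: n => [|n IH]; first by rewrite big_geq // invr1 subrr.
rewrite big_nat_recr //= IH natrM.
have h : 0 <= n%:R :> R by rewrite ler0n.
have -> : n.+2%:R = n%:R + 2 :> R by rewrite -natrD addn2.
have -> : n.+1%:R = n%:R + 1 :> R by rewrite natr1.
by field; lra.
Qed.

(** [- ln (1 - 1 / p)] is at most [1 / (p - 1) = 1 / p + 1 / (p (p - 1))]. Summation gives at most
    [300 + ln (lg N) / 2] and [1]; the half of [ln (lg N)] becomes the square root. *)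
Lemma inert_prod_ge N : (2 <= N)%N ->
  Rtrigo_def.exp (- 301) <= \prod_(p <- index_iota 2 N.+1 | inert p) (1 - p%:R^-1) * Num.sqrt (lg N).
Proof.
move=> N2; have L0 : 0 < lg N by have := lg2_ge; have := @ler_lg 2 N isT N2; lra.
have f0 (p : nat) : (2 <= p)%N -> 0 < 1 - p%:R^-1 :> R.
  by move=> p2; rewrite subr_gt0 invf_lt1 ?ltr1n // ltr0n ltnW.
have F0 : {in index_iota 2 N.+1, forall p : nat, 0 < (if inert p then 1 - p%:R^-1 else 1) :> R}.
  by move=> p; rewrite mem_index_iota => /andP[p2 _]; case: ifP => // _; apply: f0.
rewrite big_mkcond; apply: exp_le.
  by rewrite mulr_gt0 ?sqrtr_gt0 // big_seq prodr_gt0.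
rewrite lnM ?sqrtr_gt0 //; last by rewrite big_seq prodr_gt0.
rewrite ln_sqrt // ln_prod //.
have : - \sum_(2 <= p < N.+1) ((inert p)%:R / p%:R + (p * p.-1)%:R^-1) <=
    \sum_(2 <= p < N.+1) ln (if inert p then 1 - p%:R^-1 else 1).
  rewrite -sumrN !big_nat; apply: ler_sum => p /andP[p2 _].
  have p0 : 0 < p%:R :> R by rewrite ltr0n ltnW.
  case: ifP => _; last by rewrite mul0r add0r ln1 oppr_le0 invr_ge0.
  rewrite lerNl -lnV ?f0 //; apply: le_trans (ln_le_sub1 _) _; first by rewrite invr_gt0 f0.
  case: p p2 p0 => [//|[//|p]] _ _.
  have h : 0 <= p%:R :> R by rewrite ler0n.
  rewrite natrM /=; have -> : p.+2%:R = p%:R + 2 :> R by rewrite -natrD addn2.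
  have -> : p.+1%:R = p%:R + 1 :> R by rewrite natr1.
  by rewrite le_eqVlt; apply/orP; left; apply/eqP; field; rewrite !gt_eqF //; lra.
rewrite big_split /=; have := sum_inv_pronic_le N; have := inert_recip_sum N2; lra.
Qed.

Lemma good_recip_sum : exists2 c : R, 0 < c &
  forall N, (2 <= N)%N -> c * Num.sqrt (lg N) <= Hs good N.
Proof.
exists (Rtrigo_def.exp (- 301) / 4).
  by rewrite divr_gt0 // ; apply/RltP/Exp_prop.exp_pos.
move=> N N2; have L0 : 0 < lg N by have := lg2_ge; have := @ler_lg 2 N isT N2; lra.
have S : Hs (fun n => all (fun q => ~~ (q %| n)%N) (sieving N)) N <= Hs good N.
  rewrite /Hs !big_nat; apply: ler_sum => n hn.
  rewrite ler_wpM2r ?invr_ge0 ?ler0n // ler_nat.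
  by case: (boolP (all _ _)) => // /(sieving_good hn) ->.
apply: le_trans S; apply: le_trans (Hs_sieve _ _); last first.
  apply/allP => q; rewrite !mem_cat => /or3P[|/mapP[l]|].
  - by rewrite !inE => /orP[] /eqP->.
  - by rewrite mem_index_iota => /andP[l2 _] ->; rewrite expn_gt0 ltnW.
  - by rewrite mem_filter mem_index_iota => /and3P[_ q2 _]; rewrite ltnW.
rewrite !big_cons !big_cat big_map big_filter /=.
have h1 := prod_inv_sqr_ge N; have h2 := inert_prod_ge N2.
have h3 : lg N <= harmonic N by apply: le_trans (harmonic_ge N); apply: ler_lg => //; exact: ltnW.
set P1 := \prod_(_ <- _) _ in h1 *; set P2 := \prod_(_ <- _ | _) _ in h2 *.
set e := Rtrigo_def.exp _ in h2 *.
have s0 : 0 < Num.sqrt (lg N) by rewrite sqrtr_gt0.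
have ss : Num.sqrt (lg N) * Num.sqrt (lg N) = lg N by rewrite -expr2 sqr_sqrtr // ltW.
have e0 : 0 < e by apply/RltP/Exp_prop.exp_pos.
have P20 : 0 < P2 by rewrite -(pmulr_lgt0 _ s0); lra.
(* The factors from [3], [37] and the squares give [(2/3) (36/37) (1/2) > 1/4]. *)
apply: (@le_trans _ _ ((1 - 3%:R^-1) * ((1 - 37%:R^-1) * ((1 / 2) * P2)) * lg N)).
  set s := Num.sqrt (lg N) in h2 s0 ss *; rewrite -ss (mulrA _ s s) ler_pM2r //.
  have := mulr_gt0 P20 s0; lra.
apply: ler_pM (ltW L0) _ h3; first by lra.
rewrite ler_pM2l; last by lra.
by rewrite ler_pM2l ?ler_pM2r //; lra.
Qed.

(** * Counting good integers *)

Lemma split_window : exists2 K : nat, (0 < K)%N & forall Y, (K <= Y)%N ->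
  Y%:R <= K%:R * lg Y * (\sum_((Y %/ K).+1 <= p < Y.+1) split p)%:R.
Proof.
(* [564 / 2 = 140 + 141 + 1]: the errors of [psum_split_inert] at [Y] and [Y / K] are absorbed, and
   the window keeps a sum of at least [1]. *)
have [K K0 lgK] : exists2 K, (0 < K)%N & 564 <= lg K.
  exists (2 ^ (564 * 2))%N; first by rewrite expn_gt0.
  rewrite lg_exp //; have := lg2_ge; rewrite natrM; lra.
exists K => // Y KY.
have K0' : 0 < K%:R :> R by rewrite ltr0n.
have Y0 : (0 < Y)%N by apply: leq_trans KY.
have Y0' : 0 < Y%:R :> R by rewrite ltr0n.
have YK0 : (0 < Y %/ K)%N by rewrite divn_gt0.
have [/andP[h1 _] _] := psum_split_inert Y0.
have [/andP[_ h2] _] := psum_split_inert YK0.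
have h3 : lg (Y %/ K) <= lg Y - lg K.
  rewrite -ln_div //; apply: ler_ln; first by rewrite ltr0n.
  by rewrite ler_pdivlMr // -natrM ler_nat leq_trunc_div.
have h : 1 <= \sum_((Y %/ K).+1 <= p < Y.+1) (split p)%:R * (lg p / p%:R).
  have : psum Y (fun n => (split n)%:R) = psum (Y %/ K) (fun n => (split n)%:R) +
      \sum_((Y %/ K).+1 <= p < Y.+1) (split p)%:R * (lg p / p%:R).
    rewrite {1}/psum (@big_cat_nat _ _ _ (Y %/ K).+1 1 Y.+1) //=; last by rewrite ltnS leq_div.
    congr (_ + _); rewrite big_mkcond; apply: eq_bigr => p _.
    by rewrite /split; case: (prime p); rewrite //= mul0r.
  lra.
(* In the window [lg p / p <= K lg Y / Y], which turns the weighted sum into a count. *)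
have : \sum_((Y %/ K).+1 <= p < Y.+1) (split p)%:R * (lg p / p%:R) <=
    \sum_((Y %/ K).+1 <= p < Y.+1) (split p)%:R * (lg Y * K%:R / Y%:R).
  rewrite !big_nat; apply: ler_sum => p /andP[pl pY].
  have p0 : (0 < p)%N by apply: leq_trans pl.
  apply: ler_wpM2l => //; rewrite -mulrA; apply: ler_pM; rewrite ?lg_ge0 ?invr_ge0 ?ler_lg //.
  rewrite ler_pdivlMr // mulrC ler_pdivrMr ?ltr0n // -natrM ler_nat mulnC.
  by apply: leq_trans (ltnW (ltn_ceil Y K0)) _; rewrite leq_mul2r pl orbT.
rewrite -big_distrl -natr_sum /= => h4; have {h4} := le_trans h h4.
rewrite mulrA ler_pdivlMr // mul1r => h5; apply: le_trans h5 _.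
by rewrite le_eqVlt; apply/orP; left; apply/eqP; ring.
Qed.

Definition good_list N : seq nat := [seq n <- iota 1 N | good n].

Lemma good_mul_prime m p : good m -> split p -> (m < p)%N -> (3 < p)%N -> good (m * p).
Proof.
move=> /andP[m0 /allP gm] /andP[pp chip] mp p3.
have p0 := prime_gt0 pp.
have pNm : ~~ (p %| m)%N by apply/negP => /(dvdn_leq m0); rewrite leqNgt mp.
rewrite /good muln_gt0 m0 p0 /=; apply/allP => q.
rewrite primesM // (primes_prime pp) inE lognM // => /orP[qm|/eqP->].
  have /and3P[-> -> /eqP->] := gm q qm.
  rewrite (logn_prime _ pp) (_ : (q == p) = false) //.
  by apply/negP => /eqP pq; move: pNm; rewrite -pq; move: qm; rewrite mem_primes => /and3P[_ _ ->].
by rewrite chip (logn_prime _ pp) eqxx gtn_eqF // lognE (negbTE pNm) !andbF.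
Qed.

(** [K * Z ^ 2 <= N] puts every window above [Z]. In a product [m * p] the prime [p] is then the
    only prime factor exceeding [Z], so distinct pairs give distinct products. *)
Lemma good_list_ge K Z N : (3 <= Z)%N -> (0 < K)%N -> (K * Z ^ 2 <= N)%N ->
  (\sum_(1 <= m < Z.+1 | good m) \sum_(((N %/ m) %/ K).+1 <= p < (N %/ m).+1) split p
   <= size (good_list N))%N.
Proof.
move=> Z3 K0 KZ.
pose ps m := [seq p <- index_iota ((N %/ m) %/ K).+1 (N %/ m).+1 | split p].
pose ms := [seq m <- index_iota 1 Z.+1 | good m].
have psP m p : m \in ms -> p \in ps m ->
    [/\ good m, split p, (0 < m <= Z)%N, (Z < p)%N & (m * p <= N)%N].
  rewrite !mem_filter !mem_index_iota => /and3P[gm m0 mZ] /and3P[sp pl pN]; split => //; first by rewrite m0.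
    apply: leq_trans pl; rewrite ltnS !leq_divRL // .
    by apply: leq_trans KZ; rewrite mulnAC [(Z * m)%N]mulnC mulnC leq_mul2l -mulnn leq_mul2r -ltnS mZ !orbT.
  by rewrite mulnC -leq_divRL // -ltnS.
have -> : (\sum_(1 <= m < Z.+1 | good m) \sum_(((N %/ m) %/ K).+1 <= p < (N %/ m).+1) split p =
    size [seq m * p | m <- ms, p <- ps m])%N.
  rewrite size_allpairs_dep sumnE big_map /ms -big_filter; apply: eq_bigr => m _.
  by rewrite /ps size_filter -sum1_count [RHS]big_mkcond.
apply: uniq_leq_size; last first.
  move=> _ /allpairsPdep[m [p [hm hp ->]]].
  have [gm sp /andP[m0 mZ] Zp mpN] := psP m p hm hp.
  have mp : (m < p)%N by apply: leq_ltn_trans Zp.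
  rewrite /good_list mem_filter good_mul_prime // ?(leq_ltn_trans Z3) // mem_iota add1n ltnS mpN andbT.
  by rewrite muln_gt0 m0 (leq_ltn_trans (leq0n _) mp).
apply: allpairs_uniq_dep; first by rewrite filter_uniq ?iota_uniq.
  by move=> m _; rewrite filter_uniq ?iota_uniq.
move=> _ _ /allpairsPdep[m [p [hm hp ->]]] /allpairsPdep[m' [p' [hm' hp' ->]]] /= E.
have [_ /andP[pp _] /andP[m0 mZ] Zp _] := psP m p hm hp.
have [_ /andP[pp' _] /andP[m0' mZ'] Zp' _] := psP m' p' hm' hp'.
have pp_eq : p = p'.
  have : (p %| m' * p')%N by rewrite -E dvdn_mull.
  rewrite Euclid_dvdM // => /orP[/(dvdn_leq m0')|]; last by rewrite dvdn_prime2 // => /eqP.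
  by rewrite leqNgt (leq_ltn_trans mZ' Zp).
move: E; rewrite -pp_eq => /eqP; rewrite eqn_mul2r => /orP[/eqP p0|/eqP->//].
by move: pp; rewrite p0.
Qed.

Lemma good_list_lower : exists2 c : R, 0 < c & exists N0 : nat, forall N, (N0 <= N)%N ->
  c * N%:R / Num.sqrt (lg N) <= (size (good_list N))%:R.
Proof.
have [K K0 win] := split_window.
have [c c0 hc] := good_recip_sum.
have K0' : 0 < K%:R :> R by rewrite ltr0n.
exists (c / (4 * K%:R)); first by rewrite divr_gt0 // mulr_gt0.
exists (16 * K ^ 2)%N => N hN.
have N0 : (0 < N)%N by apply: leq_trans hN; rewrite muln_gt0 expn_gt0 K0.
(* [Z] is the integer part of [sqrt (N / K)]. *)
have [Z Z3 [KZ NZ]] : exists2 Z, (3 <= Z)%N & (K * Z ^ 2 <= N)%N /\ (N < K * Z.+1 ^ 2)%N.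
  have ex : exists Z, (K * Z ^ 2 <= N)%N by exists 0%N; rewrite exp0n // muln0.
  have bd Z : (K * Z ^ 2 <= N)%N -> (Z <= N)%N.
    move=> h; case: Z h => // Z h; apply: leq_trans h.
    by rewrite -mulnn mulnA leq_pmull // muln_gt0 K0.
  case: (ex_maxnP ex bd) => Z h1 h2; exists Z.
    by apply: h2; apply: leq_trans hN; rewrite mulnC -mulnn mulnA leq_mul2r; apply/orP; right; lia.
  by split=> //; rewrite ltnNge; apply/negP => /h2; rewrite ltnn.
have Z0 : (0 < Z)%N by apply: leq_trans Z3.
(* This combines [N <= 4 K Z^2] with [N >= 16 K^2]. *)
have lZ : lg N / 4 <= lg Z.
  have h1 : lg N <= lg (4 * K) + 2 * lg Z.
    have -> : 2 * lg Z = lg (Z ^ 2) by rewrite lg_exp.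
    rewrite -lgM ?muln_gt0 ?expn_gt0 ?Z0 ?K0 //; apply: ler_lg => //; apply: ltnW.
    by apply: leq_trans NZ _; nia.
  have h2 : 2 * lg (4 * K) <= lg N.
    have -> : 2 * lg (4 * K) = lg ((4 * K) ^ 2) by rewrite lg_exp // muln_gt0 K0.
    by apply: ler_lg; [rewrite expn_gt0 muln_gt0 K0|apply: leq_trans hN; rewrite expnMn].
  lra.
have lN : 0 < lg N.
  have : (2 <= N)%N by apply: leq_trans hN; lia.
  by move=> /(@ler_lg 2 N isT); have := lg2_ge; lra.
have {}hc := hc Z (ltnW Z3).
set s := Num.sqrt (lg N).
have s0 : 0 < s by rewrite sqrtr_gt0.
have ss : s * s = lg N by rewrite -expr2 sqr_sqrtr // ltW.
have sZ : s / 2 <= Num.sqrt (lg Z).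
  rewrite -(ler_pXn2r (ltn0Sn 1)) ?nnegrE ?sqrtr_ge0 ?divr_ge0 ?(ltW s0) //.
  rewrite sqr_sqrtr ?lg_ge0 // exprMn expr2 ss; lra.
have N0' : 0 < N%:R :> R by rewrite ltr0n.
(* For each good [m], [split_window] at [Y = N / m] yields at least [N / (2 K m lg N)] primes. *)
have count : N%:R / (2 * K%:R * lg N) * Hs good Z <= (size (good_list N))%:R.
  apply: (@le_trans _ _ (\sum_(1 <= m < Z.+1 | good m)
      \sum_(((N %/ m) %/ K).+1 <= p < (N %/ m).+1) split p)%:R); last first.
    by rewrite ler_nat; apply: good_list_ge KZ.
  rewrite natr_sum /Hs big_distrr /= [X in _ <= X]big_mkcond !big_nat.
  apply: ler_sum => m /andP[m0 mZ]; case: ifP => _; last by rewrite mul0r mulr0.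
  set Y := (N %/ m)%N.
  have m0' : 0 < m%:R :> R by rewrite ltr0n.
  have KY : (K <= Y)%N.
    rewrite leq_divRL //; apply: leq_trans KZ; rewrite leq_mul2l -mulnn; apply/orP; right.
    by apply: (leq_trans (mZ : (m <= Z)%N)); rewrite leq_pmull.
  have Y0 : (0 < Y)%N by apply: leq_trans KY.
  have YN : lg Y <= lg N by rewrite ler_lg // leq_div.
  have NY : (N <= 2 * m * Y)%N.
    apply: leq_trans (ltnW (ltn_ceil N m0)) _.
    by rewrite -/Y mulnAC leq_mul2r; apply/orP; right; lia.
  have := win Y KY; set W := bigop _ _ _ => hW.
  have NYr : N%:R <= 2 * m%:R * Y%:R :> R by rewrite -!natrM ler_nat.
  rewrite mul1r mulrAC -mulrA -invfM ler_pdivrMr ?mulr_gt0 //.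
  apply: le_trans NYr _.
  have W0 : 0 <= W%:R :> R by rewrite ler0n.
  have hW' : Y%:R <= K%:R * lg N * W%:R.
    by apply: le_trans hW _; rewrite ler_wpM2r // ler_wpM2l // ltW.
  have := ler_wpM2l (ltW m0') hW'; lra.
apply: le_trans count.
have -> : c / (4 * K%:R) * N%:R / s = N%:R / (2 * K%:R * lg N) * (c * (s / 2)).
  by rewrite -ss; field; rewrite !gt_eqF.
rewrite ler_wpM2l ?divr_ge0 ?mulr_ge0 ?ler0n ?(ltW lN) //.
by apply: le_trans hc; rewrite ler_wpM2l // ltW.
Qed.

(** * From good integers to quadratic fields *)

Lemma norm37_prime p : prime p -> chi p = 1 -> norm37 (Z.of_nat p).
Proof.
move=> pp chip; have [a [pa le37]] := chi_square_mod pp chip.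
apply: (@norm37_of_sqr_mod _ (Z.of_nat a)).
- by have := prime_gt0 pp; lia.
- have : odd p by case: (even_prime pp) => // p2; move: chip; rewrite p2.
  by move=> op; exists (Z.of_nat p./2); have := odd_double_half p; rewrite op -muln2; lia.
- by case/dvdnP: pa => k hk; exists (Z.of_nat k); move: hk le37; rewrite -mulnn; lia.
Qed.

(** Relaxes [good] by admitting the factor [3], so that it covers the values of [lift3]. *)
Definition nice m := (0 < m)%N && all (fun p => (chi p == 1) && (logn p m == 1%N)) (primes m).

Lemma nice_norm37 m : nice m -> norm37 (Z.of_nat m).
Proof.
move=> /andP[m0 /allP h].
have {h} : forall p, prime p -> (p %| m)%N -> chi p = 1.
  move=> p pp pm; have pm' : p \in primes m by rewrite mem_primes pp m0.
  by have /andP[/eqP] := h p pm'.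
elim/ltn_ind: m m0 => m IH m0 h.
case: (ltngtP m 1%N) => [|m1|->]; [by rewrite ltnS leqn0 (gtn_eqF m0)| |exact: norm37_1].
have pp := pdiv_prime m1; have pm := pdiv_dvd m.
have -> : Z.of_nat m = Z.mul (Z.of_nat (pdiv m)) (Z.of_nat (m %/ pdiv m)).
  by rewrite -Nat2Z.inj_mul; congr Z.of_nat; rewrite [RHS]mulnC divnK.
apply: norm37_mul; first exact: norm37_prime (h _ pp pm).
apply: IH.
- by rewrite ltn_Pdiv // prime_gt1.
- by rewrite divn_gt0 ?prime_gt0 // dvdn_leq.
- by move=> q qp qd; apply: h => //; apply: dvdn_trans qd (dvdn_div pm).
Qed.

Lemma nice_squarefree m : nice m -> squarefree (Z.of_nat m).
Proof.
move=> /andP[m0 /allP h] k [q hq]; set a := Z.abs_nat k.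
have dm : (a ^ 2 %| m)%N.
  by apply/dvdnP; exists (Z.to_nat q); rewrite -mulnn /a; nia.
suff a1 : a = 1%N by rewrite /a in a1; nia.
case: (ltngtP a 1%N) => // [|a1].
  by rewrite ltnS leqn0 => /eqP a0; move: dm; rewrite a0 dvd0n (gtn_eqF m0).
have pp := pdiv_prime a1.
have pm : (pdiv a ^ 2 %| m)%N by apply: dvdn_trans dm; rewrite dvdn_exp2r // pdiv_dvd.
have /andP[_ /eqP l1] : (chi (pdiv a) == 1) && (logn (pdiv a) m == 1%N).
  by apply: h; rewrite mem_primes pp m0; apply: dvdn_trans pm; rewrite dvdn_exp.
by move: pm; rewrite pfactor_dvdn // l1.
Qed.

Lemma nice_dvd m p : nice m -> prime p -> (p %| m)%N -> chi p = 1.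
Proof.
move=> /andP[m0 /allP h] pp pm; have pm' : p \in primes m by rewrite mem_primes pp m0.
by have /andP[/eqP] := h p pm'.
Qed.

Lemma nice_good_field m : nice m -> (m %% 4 = 3)%N -> good_field (- 37 * Z.of_nat m).
Proof.
move=> nm m4; apply: norm37_good_field.
- by case/andP: nm => m0 _; lia.
- exact: nice_squarefree.
- have -> : Z.of_nat m = Z.add 3 (Z.mul (Z.of_nat (m %/ 4)) 4).
    by have := divn_eq m 4; rewrite m4; lia.
  by rewrite Z.mod_add.
- move=> [k hk]; have d37 : (37 %| m)%N by apply/dvdnP; exists (Z.to_nat k); lia.
  by have /eqP := nice_dvd nm (isT : prime 37) d37.
- exact: nice_norm37.
Qed.

(* [3] splits in [Q(sqrt 37)], so it can be used to correct the class mod 4. *)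
Definition lift3 n : nat := if (n %% 4 == 3)%N then n else 3 * n.

Lemma good_nice n : good n -> nice n.
Proof.
move=> /andP[n0 /allP h]; rewrite /nice n0; apply/allP => p /h /and3P[-> _ ->] //.
Qed.

Lemma good_not3 n : good n -> ~~ (3 %| n)%N.
Proof.
move=> /andP[n0 /allP h]; apply/negP => d3.
have p3 : 3 \in primes n by rewrite mem_primes n0.
by have /and3P[] := h 3 p3.
Qed.

Lemma good_lift_nice n : good n -> nice (lift3 n).
Proof.
move=> gn; rewrite /lift3; case: ifP => _; first exact: good_nice.
have n3 := good_not3 gn; case/andP: gn => n0 /allP h.
rewrite /nice muln_gt0 n0; apply/allP => p; rewrite primesM // inE lognM // => /orP[/eqP->|pn].
  by rewrite [logn 3 n]lognE (negbTE n3) !andbF.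
have /and3P[-> p3 /eqP->] := h p pn; rewrite logn_prime // (negbTE p3) //.
Qed.

(** A good [n] is odd because [chi 2 = -1]; if it is [1] mod [4], then [3 n] is [3] mod [4]. *)
Lemma good_lift_mod4 n : good n -> (lift3 n %% 4 = 3)%N.
Proof.
move=> gn; rewrite /lift3; case: eqP => // n4.
have : ~~ (2 %| n)%N by apply/negP => /(nice_dvd (good_nice gn) (isT : prime 2))/eqP.
by lia.
Qed.

Definition disc_of n : Z := Z.mul (-37) (Z.of_nat (lift3 n)).

(** As [3] does not divide a good [n], divisibility of [lift3 n] by [3] tells whether the factor was
    inserted. *)
Lemma disc_of_inj : {in good &, injective disc_of}.
Proof.
move=> m n gm gn h; have : lift3 m = lift3 n by rewrite /disc_of in h; lia.
have := good_not3 gm; have := good_not3 gn; rewrite /lift3.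
by case: ifP => _; case: ifP => _; lia.
Qed.

Lemma field_disc_of n : good n -> field_disc (disc_of n) = disc_of n.
Proof.
move/good_lift_mod4; rewrite /field_disc /disc_of; set m := lift3 n => m4.
have -> : Z.mul (-37) (Z.of_nat m) =
    Z.add 1 (Z.mul (Z.sub (Z.mul (-37) (Z.of_nat (m %/ 4))) 28) 4).
  by have := divn_eq m 4; rewrite m4; lia.
by rewrite Z.mod_add.
Qed.

Lemma good_fields_lower : exists2 c : R, 0 < c & exists N0 : nat, forall N, (N0 <= N)%N ->
  exists ds : list Z, NoDup ds /\
    (forall d, In d ds -> good_field d /\ Z.le (Z.abs (field_disc d)) (111 * Z.of_nat N)) /\
    c * N%:R / Num.sqrt (ln N%:R) <= (length ds)%:R.
Proof.
have [c c0 [N0 h]] := good_list_lower; exists c => //; exists N0 => N hN.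
exists [seq disc_of n | n <- good_list N].
have Inmap (s : seq nat) d : In d [seq disc_of n | n <- s] -> exists2 n, n \in s & d = disc_of n.
  elim: s => [//|x s IH] /= [<-|/IH[n ns ->]]; first by exists x; rewrite ?mem_head.
  by exists n; rewrite // inE ns orbT.
split; [|split].
- have : uniq (good_list N) by rewrite filter_uniq ?iota_uniq.
  have : all good (good_list N) by apply: filter_all.
  elim: (good_list N) => [|x s IH] /=; first by constructor.
  move=> /andP[gx gs] /andP[xs us]; constructor; last exact: IH.
  move=> /Inmap[y ys /disc_of_inj E].
  by move: xs; rewrite E ?ys //; apply: (allP gs).
- move=> d /Inmap[n]; rewrite mem_filter mem_iota => /and3P[gn n1 nN] ->.
  split; first exact: nice_good_field (good_lift_nice gn) (good_lift_mod4 gn).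
  (* Here [111 = 37 * 3], since [lift3 n <= 3 n]. *)
  rewrite field_disc_of // /disc_of /lift3; case: ifP; lia.
- rewrite (_ : length _ = size [seq disc_of n | n <- good_list N]) // size_map; exact: h.
Qed.

Lemma good_fields_lower_stdlib : exists c : Rdefinitions.R, Rdefinitions.Rlt (Rdefinitions.IZR Z0) c /\
  exists N0 : nat, forall N, Peano.le N0 N ->
  exists ds : list Z, NoDup ds /\
    (forall d, In d ds -> good_field d /\ Z.le (Z.abs (field_disc d)) (111 * Z.of_nat N)) /\
    Rdefinitions.Rle (Rdefinitions.Rdiv (Rdefinitions.Rmult c (Raxioms.INR N))
      (R_sqrt.sqrt (Rpower.ln (Raxioms.INR N)))) (Raxioms.INR (length ds)).
Proof.
have [c c0 [N0 h]] := good_fields_lower; exists c; split; first exact/RltP.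
exists N0 => N /ssrnat.leP /h[ds [u [g b]]]; exists ds; do 2!split=> //.
by apply/RleP; rewrite RdivE RmultE RsqrtE !INRE.
Qed.

End Counting.

(* Passage to a real bound [X] *)
From Stdlib Require Import Reals Lra.

Theorem theorem1p2 :
  exists c : R, (c > 0)%R /\
  exists X0 : R, forall X : R, (X > X0)%R ->
    exists ds : list Z, NoDup ds /\
      (forall d : Z, In d ds -> good_field d /\ (IZR (Z.abs (field_disc d)) < X)%R) /\
      (INR (length ds) >= c * X / sqrt (ln X))%R.
Proof.
destruct Counting.good_fields_lower_stdlib as (c & c0 & N0 & H).
exists (c / 224)%R; split; [lra|].
exists (224 * (INR N0 + 3))%R; intros X HX.
assert (N00 := pos_INR N0).
destruct (archimed (X / 112)) as [U1 U2].
(* This [N] is the integer part of [X / 112]: then [111 N < X], and [N >= X / 224] because [X]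
   exceeds [224]. *)
set (N := Z.to_nat (up (X / 112) - 1)).
assert (U0 : (1 <= up (X / 112))%Z) by (apply (Zlt_le_succ 0), lt_IZR; lra).
assert (EN : INR N = (IZR (up (X / 112)) - 1)%R).
{ unfold N; rewrite INR_IZR_INZ, Znat.Z2Nat.id by lia; apply minus_IZR. }
assert (HN : (N0 <= N)%nat) by (apply INR_le; lra).
destruct (H N HN) as (ds & Hnd & Hgood & Hlen).
exists ds; split; [assumption|split].
- intros d Hd; destruct (Hgood d Hd) as [Hg Hdisc]; split; [assumption|].
  apply IZR_le in Hdisc; rewrite mult_IZR, <- INR_IZR_INZ in Hdisc; lra.
- apply Rle_ge; apply Rle_trans with (2 := Hlen).
  assert (L0 : (0 < ln (INR N))%R) by (rewrite <- ln_1; apply ln_increasing; lra).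
  assert (L1 : (ln (INR N) <= ln X)%R) by (apply Rlt_le, ln_increasing; lra).
  assert (S0 : (0 < sqrt (ln (INR N)))%R) by (apply sqrt_lt_R0; assumption).
  assert (S1 : (sqrt (ln (INR N)) <= sqrt (ln X))%R) by (apply sqrt_le_1_alt; assumption).
  unfold Rdiv at 1 3; apply Rmult_le_compat.
  + apply Rmult_le_pos; lra.
  + apply Rlt_le, Rinv_0_lt_compat; lra.
  + replace (c / 224 * X)%R with (c * (X / 224))%R by field.
    apply Rmult_le_compat_l; lra.
  + apply Rinv_le_contravar; assumption.
Qed.
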